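(* Let $d\ge 1$ and let $V=(V(x))_{x\in\mathbb{Z}^d}$ be i.i.d. non-negative random variables with $\mathbb{P}[V(0)>0]>0$ and $\mathbb{E}[\ln(V(0)+1)]<\infty$. Let $\ell\in\mathbb{R}^d$ with $\|\ell\|_2=1$. Then $$\lim_{\gamma\searrow 0}\frac{A_{\gamma V}(\ell)}{\sqrt{\gamma}}=\lim_{\gamma\searrow 0}\frac{B_{\gamma V}(\ell)}{\sqrt{\gamma}}=\sqrt{2d\,\mathbb{E}[V(0)]},$$ where $\mathbb{E}[V(0)]$ may be infinite, in which case both limits equal $\infty$.
   Context: The potential $V$ is defined on a probability space with measure $\mathbb{P}$ and expectation $\mathbb{E}$. For $\gamma>0$, $\gamma V$ is the potential $(\gamma V(x))_{x\in\mathbb{Z}^d}$. The discrete Laplacian on $\mathbb{Z}^d$ is $\Delta f(y)=\frac{1}{2d}\sum_{|e|=1}f(y+e)-f(y)$, the sum running over the $2d$ unit vectors $e\in\mathbb{Z}^d$. For an i.i.d. non-negative potential $U=(U(x))_{x\in\mathbb{Z}^d}$ with $\mathbb{P}[U(0)>0]>0$, the Green's function $G(0,\cdot,U)$ of $-\Delta+U$ is the ($\mathbb{P}$-a.s.) unique bounded solution of $(-\Delta+U)G(0,y,U)=\delta_{0,y}$, $y\in\mathbb{Z}^d$. Equivalently, if $(S(n))_{n\ge0}$ is the symmetric nearest-neighbor random walk on $\mathbb{Z}^d$ started at $0$, defined on a different probability space with expectation $E$, then $$G(0,y,U)=\sum_{m\ge0}E\Big[\exp\Big(-\sum_{n=0}^m\ln(U(S(n))+1)\Big)\mathbf{1}_{S(m)=y}\Big].$$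 Quenched exponent: if $\mathbb{E}[\ln(U(0)+1)]<\infty$, it is known that there is a (unique) non-random norm $A_U$ on $\mathbb{R}^d$ such that $\mathbb{P}$-a.s. for all $\ell\in\mathbb{Z}^d$, $$A_U(\ell)=\lim_{k\to\infty}\frac{-\ln G(0,k\ell,U)}{k}=\lim_{k\to\infty}\frac{-\mathbb{E}[\ln G(0,k\ell,U)]}{k}.$$ Annealed exponent: it is known that there is a (unique) norm $B_U$ on $\mathbb{R}^d$ such that for all $\ell\in\mathbb{Z}^d$, $$B_U(\ell)=\lim_{k\to\infty}\frac{-\ln\mathbb{E}[G(0,k\ell,U)]}{k}.$$ *)

(* Defs.v *)
(* MathComp-Analysis. *)
From HB Require Import structures.
From mathcomp Require Import all_boot all_order all_algebra.
From mathcomp Require Import all_classical all_reals all_analysis.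

Set Implicit Arguments.
Unset Strict Implicit.
Unset Printing Implicit Defensive.

Import Order.TTheory GRing.Theory Num.Theory.
Import numFieldNormedType.Exports.

Local Open Scope classical_set_scope.
Local Open Scope ring_scope.

Notation "''Zd_' d" := ('rV[int]_d) (at level 8, d at level 2, format "''Zd_' d").

Definition Zd_to_Rd (R : realType) (d : nat) (z : 'Zd_d) : 'rV[R]_d :=
  map_mx intr z.

Definition is_norm (R : realType) (d : nat) (N : 'rV[R]_d -> R) : Prop :=
  [/\ forall x y, N (x + y) <= N x + N y,
      forall a x, N (a *: x) = `|a| * N x
    & forall x, N x = 0 -> x = 0].

Definition norm2 (R : realType) (d : nat) (x : 'rV[R]_d) : R :=
  Num.sqrt (\sum_(i < d) x 0 i ^+ 2).

(* The 2d unit vectors of Z^d are the +- delta_mx 0 i, i < d. *)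
Definition laplacian (R : realType) (d : nat) (f : 'Zd_d -> R) (y : 'Zd_d) : R :=
  (2 * d)%:R^-1 *
  \sum_(i < d) ((f (y + delta_mx 0 i) - f y) + (f (y - delta_mx 0 i) - f y)).

Definition bounded_green_solution (R : realType) (d : nat)
    (U : 'Zd_d -> R) (g : 'Zd_d -> R) : Prop :=
  (exists M : R, forall y, `|g y| <= M) /\
  (forall y, - laplacian g y + U y * g y = (y == 0)%:R).

(* [green U y] is G(0, y, U) whenever the equation (- Delta + U) g = delta_0
   has exactly one bounded solution.  For an i.i.d. non-negative U that is not
   a.s. zero, this is the case almost surely; on the exceptional null event the
   value is 0 by convention. *)
Definition green (R : realType) (d : nat) (U : 'Zd_d -> R) : 'Zd_d -> R :=
  xget (fun=> 0) [set g | unique (bounded_green_solution U) g].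

Section random_potential.
Context (dT : measure_display) (T : measurableType dT) (R : realType).
Variable P : probability T R.

Definition mutually_independent (I : choiceType) (X : I -> {RV P >-> R}) : Prop :=
  forall (s : seq I) (B : I -> set R), uniq s ->
    (forall i, measurable (B i)) ->
    P (\bigcap_(i in [set` s]) (X i @^-1` B i)) =
    (\prod_(i <- s) P (X i @^-1` B i))%E.

Definition identically_distributed (I : choiceType) (X : I -> {RV P >-> R}) : Prop :=
  forall (i j : I) (B : set R), measurable B ->
    distribution P (X i) B = distribution P (X j) B.

Definition iid (I : choiceType) (X : I -> {RV P >-> R}) : Prop :=
  mutually_independent X /\ identically_distributed X.

(* A random potential is U : Z^d -> T -> R and [U ^~ w] is its realization at w.
   The two predicates below determine N uniquely: a norm on R^d is determined
   by its values on Z^d. *)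
Definition is_quenched_exponent (d : nat) (U : 'Zd_d -> T -> R)
    (N : 'rV[R]_d -> R) : Prop :=
  [/\ is_norm N,
      {ae P, forall w, forall l : 'Zd_d,
        (fun k : nat => - ln (green (U ^~ w) (l *+ k)) / k%:R) @ \oo
          --> N (Zd_to_Rd R l)}
    & forall l : 'Zd_d,
        (fun k : nat => - 'E_P[fun w => ln (green (U ^~ w) (l *+ k))]
                          * (k%:R^-1)%:E)%E @ \oo
          --> (N (Zd_to_Rd R l))%:E].

Definition is_annealed_exponent (d : nat) (U : 'Zd_d -> T -> R)
    (N : 'rV[R]_d -> R) : Prop :=
  is_norm N /\
  forall l : 'Zd_d,
    (fun k : nat => - lne 'E_P[fun w => green (U ^~ w) (l *+ k)]
                      * (k%:R^-1)%:E)%E @ \oo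
      --> (N (Zd_to_Rd R l))%:E.

End random_potential.

(* Main.v *)
Require Import Defs.
From HB Require Import structures.
From mathcomp Require Import all_boot all_order all_algebra.
From mathcomp Require Import all_classical all_reals all_analysis.
From mathcomp Require Import measurable_realfun ring lra zify.
Import Order.TTheory GRing.Theory Num.Theory.
Import numFieldNormedType.Exports.
Local Open Scope classical_set_scope.
Local Open Scope ring_scope.

(** Write [avg f y] for the mean of [f] over the neighbours of [y].  The Green's
    function is the increasing limit of the functions [greenN U n], given by
    [g_(n+1) = (avg g_n + delta_0) / (1 + U)] and [g_0 = 0] ([cvg_greenN]).  All
    estimates are comparison arguments for this recursion, proved by induction on
    [n].  Both exponents are squeezed between the same two bounds.

    Upper bound.  The Green's function is log-convex in [ln (1 + U)].  By Jensen's
    inequality the means of [ln G] and of [G] are therefore at least those for a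
    constant potential [c] with [1 + c = expR (gamma * E V)] ([greenN_jensen]).  For
    a constant potential, [exp (- theta * sqrt (|y|^2 + 1))] is a subsolution far
    from the origin as soon as [theta^2 > 2 d c] ([radial_subharmonic]), hence
    bounds the Green's function from below up to a constant factor
    ([radial_le_greenN]).  As [c] is equivalent to [gamma * E V], the exponents are at
    most [sqrt (2 d gamma E V)] to first order.

    Lower bound.  The mean [m] of [G] satisfies
    [m y + gamma * E (V y * G y) = avg m y + delta_0 y].  If [V y] and [G y] were
    independent, [m] would be the Green's function for the constant [gamma * E V].
    Removing the potential at [y] makes [G y] independent of [V y], and changes it by
    a factor at most [1 + gamma * V y * G_yy], where [G_yy] is the mean number of
    visits of the walk to [y].  In low dimensions [G_yy] need not be small compared
    with [1 / gamma].  So part of the potential is discarded: space is cut into slabs of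
    width [L] orthogonal to [l], and the walk, which starts high up and must come
    down to the origin, is charged in a slab only until it first goes below it
    ([levelN]).  What is left of a level is a walk killed at the exit from a half
    space, and it visits a site at most [2 d (L + 1)] times on average
    ([avg_exit_barrier]); hence the relative error is of order [gamma * L]
    ([levelN_single_site], [mean_site_charge]).  The resulting equation with constant
    killing rate [a] has a supersolution that loses a factor [cosh (theta (L - 1))] per
    slab, where [theta^2] is close to [2 d a] ([level_bound_super]).  Thus
    the exponents in direction [l] are at least [ln (cosh (theta (L - 1))) / L], which is
    close to [theta] when [L] is large compared with [1 / theta].  As [theta] is of order
    [gamma^(1/2)], widths [L] between [gamma^(-1/2)] and [gamma^(-1)] make both errors
    vanish ([slab_parameters]).  The potential is first truncated at a level [M],
    which is sent to infinity last.

    Since a norm on [R^d] is determined by its values on [Z^d], a bound along all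
    lattice directions, linear in the height over [l] for the lower bound, gives
    the bound at [l] ([norm_le_of_lattice], [norm_ge_of_lattice]). *)

Set Implicit Arguments.
Unset Strict Implicit.
Unset Printing Implicit Defensive.

(** * Neighbour averages and finite-step Green's functions *)

Definition neighbour (d : nat) (y x : 'Zd_d) : Prop :=
  exists i, x = y + delta_mx 0 i \/ x = y - delta_mx 0 i.

Definition avg (R : realType) (d : nat) (f : 'Zd_d -> R) (y : 'Zd_d) : R :=
  (2 * d)%:R^-1 * \sum_(i < d) (f (y + delta_mx 0 i) + f (y - delta_mx 0 i)).

Section avg.
Context (R : realType) (d : nat).
Implicit Types (f g : 'Zd_d -> R) (y : 'Zd_d).

Lemma le_avg f g y : (forall x, neighbour y x -> f x <= g x) -> avg f y <= avg g y.
Proof.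
move=> fg; rewrite /avg ler_wpM2l ?invr_ge0//.
by apply: ler_sum => i _; apply: lerD; apply: fg; exists i; [left|right].
Qed.

Lemma eq_avg f g y : (forall x, neighbour y x -> f x = g x) -> avg f y = avg g y.
Proof.
move=> fg; apply/eqP; rewrite eq_le; apply/andP.
by split; apply: le_avg => x /fg ->.
Qed.

Lemma avgD f g y : avg (fun x => f x + g x) y = avg f y + avg g y.
Proof.
rewrite /avg -mulrDr -big_split /=; congr (_ * _).
by apply: eq_bigr => i _; rewrite addrACA.
Qed.

Lemma avgZ (a : R) f y : avg (fun x => a * f x) y = a * avg f y.
Proof.
rewrite /avg [RHS]mulrCA; congr (_ * _); rewrite mulr_sumr.
by apply: eq_bigr => i _; rewrite mulrDr.
Qed.

Lemma avgB f g y : avg (fun x => f x - g x) y = avg f y - avg g y.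
Proof.
rewrite -[X in _ = _ + X]mulN1r -(avgZ (- 1) g y) -avgD.
by apply: eq_avg => x _; rewrite mulN1r.
Qed.

Lemma avg_cst (a : R) y : (0 < d)%N -> avg (fun=> a) y = a.
Proof.
move=> d0; rewrite /avg sumr_const card_ord -mulr2n -mulrnA -[a *+ _]mulr_natl.
by rewrite mulrA mulVf ?mul1r// pnatr_eq0 muln_eq0/= -lt0n.
Qed.

Lemma avg_ge0 f y : (forall x, neighbour y x -> 0 <= f x) -> 0 <= avg f y.
Proof.
move=> f0; rewrite mulr_ge0 ?invr_ge0// sumr_ge0// => i _.
by rewrite addr_ge0// f0//; exists i; [left|right].
Qed.

Lemma avg_ge_neighbour f y x : (forall z, 0 <= f z) -> neighbour y x ->
  (2 * d)%:R^-1 * f x <= avg f y.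
Proof.
move=> f0 [i xE]; rewrite /avg ler_wpM2l ?invr_ge0// (bigD1 i)//=.
have rest : 0 <= \sum_(j < d | j != i) (f (y + delta_mx 0 j) + f (y - delta_mx 0 j)).
  by apply: sumr_ge0 => j _; exact: addr_ge0.
have := f0 (y + delta_mx 0 i); have := f0 (y - delta_mx 0 i).
by case: xE => ->; lra.
Qed.

Lemma ler_norm_avg f y M : (0 < d)%N ->
  (forall x, `|f x| <= M) -> `|avg f y| <= M.
Proof.
move=> d0 fM; rewrite ler_norml -{1}(avg_cst (- M) y d0) -{2}(avg_cst M y d0).
by apply/andP; split; apply: le_avg => x _; have := fM x; rewrite ler_norml => /andP[].
Qed.

Lemma cvg_avg (F : nat -> 'Zd_d -> R) f y :
  (forall x, (fun n => F n x) @ \oo --> f x) -> (fun n => avg (F n) y) @ \oo --> avg f y.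
Proof.
move=> Ff; rewrite /avg; apply: cvgMl_tmp => //.
apply: cvg_big => [|i _]; first exact: add_continuous.
exact: cvgD.
Qed.

Lemma laplacianE f y : (0 < d)%N -> laplacian f y = avg f y - f y.
Proof.
move=> d0; rewrite -[X in _ - X](avg_cst _ y d0) -avgB /avg.
by [].
Qed.

End avg.

(** The part of the Green's function carried by the walks of fewer than [n]
    steps.  It depends on finitely many values of the potential only, and its
    estimates are inductions on [n], which is why every estimate below is made
    for it and only then passed to the limit. *)
Fixpoint greenN (R : realType) (d : nat) (U : 'Zd_d -> R) (n : nat) (y : 'Zd_d) : R :=
  if n is m.+1 then (avg (greenN U m) y + (y == 0)%:R) / (1 + U y) else 0.

Section greenN.
Context (R : realType) (d : nat).
Variable U : 'Zd_d -> R.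
Hypothesis d0 : (0 < d)%N.
Hypothesis U0 : forall x, 0 <= U x.

Let U1 x : 0 < 1 + U x.
Proof. by rewrite ltr_pwDl. Qed.

Lemma greenN_ge0 n y : 0 <= greenN U n y.
Proof.
elim: n y => [|n IH] y //=.
by rewrite divr_ge0 ?(ltW (U1 _))// addr_ge0// avg_ge0.
Qed.

Lemma greenN_leS n y : greenN U n y <= greenN U n.+1 y.
Proof.
elim: n y => [|n IH] y; first exact: (greenN_ge0 1).
rewrite [leLHS]/= [leRHS]/= ler_pM2r ?invr_gt0// lerD2r.
exact: le_avg.
Qed.

Lemma greenN_nondecreasing y : {homo greenN U ^~ y : m n / (m <= n)%N >-> m <= n}.
Proof. by apply/nondecreasing_seqP => n; exact: greenN_leS. Qed.

Lemma greenN_le_steps n y : greenN U n y <= n%:R.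
Proof.
elim: n y => [|n IH] y //=.
rewrite ler_pdivrMr//; apply: (@le_trans _ _ (n%:R + 1)).
  rewrite lerD ?lern1 ?leq_b1// -(avg_cst n%:R y d0); exact: le_avg.
by rewrite natr1 ler_peMr// lerDl.
Qed.

Lemma bounded_green_solutionE g y : bounded_green_solution U g ->
  (1 + U y) * g y = avg g y + (y == 0)%:R.
Proof.
move=> [_ /(_ y)]; rewrite laplacianE// => <-.
by ring.
Qed.

Lemma greenN_le_bounded g M : bounded_green_solution U g ->
  (forall y, `|g y| <= M) -> forall n y, `|g y - greenN U n y| <= M.
Proof.
move=> solg gM; elim=> [|n IH] y; first by rewrite subr0.
have -> : g y - greenN U n.+1 y = avg (fun x => g x - greenN U n x) y / (1 + U y).
  apply: (mulfI (lt0r_neq0 (U1 y))); rewrite mulrBr bounded_green_solutionE//=.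
  by rewrite avgB; field; rewrite lt0r_neq0.
rewrite normrM normfV (gtr0_norm (U1 y)) ler_pdivrMr//.
apply: le_trans (ler_norm_avg _ d0 IH) _.
have M0 : 0 <= M by apply: le_trans (gM 0).
by rewrite ler_peMr// lerDl.
Qed.

(** The differences between a bounded solution and [greenN U n] stay bounded, so
    that [greenN] increases to a bounded solution, which is the given one. *)
Lemma cvg_greenN g : unique (bounded_green_solution U) g ->
  forall y, greenN U n y @[n --> \oo] --> g y.
Proof.
move=> [solg uniqg]; have [[M gM] _] := solg.
have bndN y n : greenN U n y <= M + M.
  have := greenN_le_bounded solg gM n y; have := gM y.
  rewrite !ler_norml => /andP[_ gyM] /andP[+ _].
  by rewrite lerBrDr addrC -lerBrDr opprK => /le_trans; apply; rewrite lerD2r.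
have cvgN y : greenN U n y @[n --> \oo] --> limn (greenN U ^~ y).
  apply: nondecreasing_is_cvgn; first exact: greenN_nondecreasing.
  by exists (M + M) => _ [n _ <-].
pose G y := limn (greenN U ^~ y).
suff -> : g = G by [].
apply: uniqg; split.
  exists (M + M) => y; rewrite ger0_norm.
    by apply: limr_le; [exact: cvgN|near=> n].
  by apply: limr_ge; [exact: cvgN|near=> n; exact: greenN_ge0].
move=> y; rewrite laplacianE//.
suff : (1 + U y) * G y = avg G y + (y == 0)%:R by rewrite mulrDl mul1r => E; lra.
have h1 : (1 + U y) * greenN U n.+1 y @[n --> \oo] --> (1 + U y) * G y.
  by apply: cvgMl_tmp => //; rewrite (cvg_shiftS (greenN U ^~ y)); exact: cvgN.
have h2 : (1 + U y) * greenN U n.+1 y @[n --> \oo] --> avg G y + (y == 0)%:R.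
  rewrite (_ : (fun _ => _) = (fun n => avg (greenN U n) y + (y == 0)%:R)).
    by apply: cvgD; [apply: cvg_avg => x; exact: cvgN|exact: cvg_cst].
  by apply/funext => n /=; field; rewrite lt0r_neq0.
by rewrite -(cvg_lim _ h1)// -(cvg_lim _ h2).
Unshelve. all: by end_near. Qed.

Lemma greenN_le g n y : unique (bounded_green_solution U) g -> greenN U n y <= g y.
Proof.
move=> ug; have gy : greenN U k y @[k --> \oo] --> g y by exact: cvg_greenN.
rewrite -(cvg_lim _ gy)//.
apply: nondecreasing_cvgn_le; first exact: greenN_nondecreasing.
by apply/cvg_ex; exists (g y).
Qed.

End greenN.

(** * Integrals of functions that need not be measurable *)

Section integral_comparison.
Import HBNNSimple.
Context (dT : measure_display) (T : measurableType dT) (R : realType).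
Variable mu : {measure set T -> \bar R}.
Local Open Scope ereal_scope.

(** [green] agrees with a measurable function only off a null set that need not
    be measurable itself.  The integral of a nonnegative function is a supremum
    over the simple functions below it, so that comparisons need the
    measurability of one side only. *)
Lemma ae_ge0_integral_le (f g : T -> \bar R) :
  (forall x, 0 <= f x) -> (forall x, 0 <= g x) -> measurable_fun setT g ->
  {ae mu, forall x, f x <= g x} -> \int[mu]_x f x <= \int[mu]_x g x.
Proof.
move=> f0 g0 mg fg; rewrite ge0_integralTE//.
apply: ge_ereal_sup => _ [h /= hf <-].
rewrite -integralT_nnsfun; apply: ae_ge0_le_integral => //.
- by move=> x _; rewrite lee_fin; exact: fun_ge0.
- exact/measurable_EFinP.
- by apply: filterS fg => x fgx _; exact: le_trans (hf x) fgx.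
Qed.

(** A simple function below [f] almost everywhere stays below [g] once it is
    set to zero on the exceptional null set, which keeps its integral. *)
Lemma ae_ge0_le_integral_min (f g : T -> \bar R) :
  (forall x, 0 <= f x) -> (forall x, 0 <= g x) -> measurable_fun setT f ->
  {ae mu, forall x, f x <= g x} -> \int[mu]_x f x <= \int[mu]_x g x.
Proof.
move=> f0 g0 mf [N [mN muN fgN]].
have mNC : measurable (~` N) by exact: measurableC.
have mfN : measurable_fun setT (f \_ (~` N)).
  by apply/(measurable_restrictT _ mNC); exact: measurable_funS mf.
have fN0 x : 0 <= (f \_ (~` N)) x by apply: erestrict_ge0.
have -> : \int[mu]_x f x = \int[mu]_x (f \_ (~` N)) x.
  apply: ge0_ae_eq_integral => //.
  exists N; split => // x /=; apply: contra_notP => Nx _.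
  by rewrite patchE mem_set.
rewrite [leLHS]ge0_integralTE// [leRHS]ge0_integralTE//.
apply: ge_ereal_sup => _ [h /= hf <-]; apply: ereal_sup_ubound; exists h => //= x.
apply: le_trans (hf x) _; rewrite patchE; case: ifPn => // /set_mem Nx.
by apply/not_notP => fgx; apply: Nx; exact: fgN.
Qed.

Lemma ae_integral_le (f g : T -> \bar R) : measurable_fun setT g ->
  {ae mu, forall x, f x <= g x} -> \int[mu]_x f x <= \int[mu]_x g x.
Proof.
move=> mg fg; rewrite integralE [leRHS]integralE leeB//.
  apply: ae_ge0_integral_le => //; first exact: measurable_funepos.
  by apply: filterS fg => x fgx; rewrite !funeposE ge_max !le_max fgx lexx/= orbT.
apply: ae_ge0_le_integral_min => //; first exact: measurable_funeneg.
by apply: filterS fg => x fgx; rewrite !funenegE ge_max !le_max leeN2 fgx lexx/= orbT.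
Qed.

Lemma ae_le_integral_min (f g : T -> \bar R) : measurable_fun setT f ->
  {ae mu, forall x, f x <= g x} -> \int[mu]_x f x <= \int[mu]_x g x.
Proof.
move=> mf fg; rewrite integralE [leRHS]integralE leeB//.
  apply: ae_ge0_le_integral_min => //; first exact: measurable_funepos.
  by apply: filterS fg => x fgx; rewrite !funeposE ge_max !le_max fgx lexx/= orbT.
apply: ae_ge0_integral_le => //; first exact: measurable_funeneg.
by apply: filterS fg => x fgx; rewrite !funenegE ge_max !le_max leeN2 fgx lexx/= orbT.
Qed.

End integral_comparison.

(** * Jensen's inequality along the recursion *)

Section centered.
Context (dT : measure_display) (T : measurableType dT) (R : realType).
Variable P : probability T R.

Definition centered (Q : T -> R) : Prop :=
  P.-integrable setT (EFin \o Q) /\ (\int[P]_w (Q w)%:E = 0)%E.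

Lemma centered0 : centered (fun=> 0).
Proof. by split; [exact: integrable0|rewrite integral0]. Qed.

Lemma centeredD Q1 Q2 : centered Q1 -> centered Q2 -> centered (fun w => Q1 w + Q2 w).
Proof.
move=> [i1 e1] [i2 e2]; split; first exact: (integrableD _ i1 i2).
by under eq_integral do rewrite EFinD; rewrite integralD// e1 e2 adde0.
Qed.

Lemma centeredZ (a : R) Q : centered Q -> centered (fun w => a * Q w).
Proof.
move=> [i e]; split; first exact: (integrableZl _ a i).
by under eq_integral do rewrite EFinM; rewrite integralZl// e mule0.
Qed.

Lemma centered_avg d (Q : 'Zd_d -> T -> R) y :
  (forall x, centered (Q x)) -> centered (fun w => avg (Q ^~ w) y).
Proof.
move=> cQ; apply: centeredZ.
suff sumQ (r : seq 'I_d) : centered (fun w =>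
    \sum_(i <- r) (Q (y + delta_mx 0 i) w + Q (y - delta_mx 0 i) w)) by exact: sumQ.
elim: r => [|i r IH].
  by rewrite (_ : (fun=> _) = fun=> 0); [exact: centered0|apply/funext => w; rewrite big_nil].
rewrite (_ : (fun=> _) = fun w => (Q (y + delta_mx 0 i) w + Q (y - delta_mx 0 i) w) +
    \sum_(i <- r) (Q (y + delta_mx 0 i) w + Q (y - delta_mx 0 i) w)).
  by do 2 apply: centeredD => //.
by apply/funext => w; rewrite big_cons.
Qed.

End centered.

(** Weighted convexity of the exponential: each [expR (q x)] lies above its
    tangent at the weighted mean [m] of the exponents, the exponent [0] being
    the one of the source [a]. *)
Lemma avg_expR_ge (R : realType) d (h q : 'Zd_d -> R) y (a : R) :
  (forall x, 0 <= h x) -> 0 <= a -> 0 < avg h y + a ->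
  (avg h y + a) * expR (avg (fun x => h x * q x) y / (avg h y + a)) <=
  avg (fun x => h x * expR (q x)) y + a.
Proof.
move=> h0 a0 H0; set H := avg h y + a; set m := _ / H.
have tangent t : expR m * (1 + (t - m)) <= expR t.
  by rewrite -{2}(subrKC m t) expRD ler_pM2l ?expR_gt0// expR_ge1Dx.
have avg_tangent : avg (fun x => h x * expR (q x)) y >=
    expR m * (avg (fun x => h x * q x) y + (1 - m) * avg h y).
  rewrite -avgZ -avgD -avgZ; apply: le_avg => x _.
  have := ler_wpM2l (h0 x) (tangent (q x)).
  by apply: le_trans; rewrite le_eqVlt; apply/orP; left; apply/eqP; ring.
have a_tangent : expR m * ((1 - m) * a) <= a.
  have := ler_wpM2l a0 (tangent 0); rewrite expR0 mulr1; apply: le_trans.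
  by rewrite le_eqVlt; apply/orP; left; apply/eqP; ring.
apply: le_trans (lerD avg_tangent a_tangent).
have -> : avg (fun x => h x * q x) y = m * H by rewrite divfK ?gt_eqF.
by rewrite le_eqVlt; apply/orP; left; apply/eqP; rewrite /H; ring.
Qed.

(** The Green's function is log-convex in [ln (1 + U)], being a sum over walks of
    exponentials of linear functions of it, so replacing these logarithms by
    their means lowers the mean of [ln G].  The centered variable [Q] is the
    linear part, made of the [b - U x] weighted by the expected numbers of visits.
    The inequality [1 + U <= expR U] allows the mean [b] of [U] to replace that of
    [ln (1 + U)]. *)
Lemma greenN_jensen (dT : measure_display) (T : measurableType dT) (R : realType)
    (P : probability T R) d (U : 'Zd_d -> T -> R) (b : R) :
  (0 < d)%N -> 0 <= b -> (forall x w, 0 <= U x w) ->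
  (forall x, centered P (fun w => b - U x w)) ->
  forall n y, exists2 Q, centered P Q &
    forall w, greenN (fun=> expR b - 1) n y * expR (Q w) <= greenN (U ^~ w) n y.
Proof.
move=> d0 b0 U0 cU; elim=> [|n IH] y.
  by exists (fun=> 0); [exact: centered0|move=> w; rewrite mul0r].
have c0 : 0 <= expR b - 1 by rewrite subr_ge0 -expR0 ler_expR.
pose h : 'Zd_d -> R := greenN (fun=> expR b - 1) n.
have h0 x : 0 <= h x by apply: greenN_ge0.
pose H := avg h y + (y == 0)%:R.
have H0 : 0 <= H by rewrite addr_ge0// avg_ge0.
have hS : greenN (fun=> expR b - 1) n.+1 y = H * expR (- b).
  by rewrite /= expRN; congr (_ / _); ring.
have [{}H0|HN0] := ltP 0 H; last first.
  exists (fun=> 0); first exact: centered0.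
  move=> w; rewrite hS (_ : H = 0) ?mul0r; first exact: greenN_ge0.
  by apply/eqP; rewrite eq_le HN0.
have /choice[q /all_and2[cq qh]] : forall x, exists Q, centered P Q /\ forall w, h x * expR (Q w) <= greenN (U ^~ w) n x.
  by move=> x; have [Q cQ Qh] := IH x; exists Q.
exists (fun w => H^-1 * avg (fun x => h x * q x w) y + (b - U y w)).
  apply: centeredD => //; apply: centeredZ; apply: centered_avg => x.
  exact: centeredZ.
move=> w; set A := H^-1 * _.
have -> : greenN (fun=> expR b - 1) n.+1 y * expR (A + (b - U y w)) =
    (H * expR A) * expR (- U y w).
  by rewrite hS -!mulrA -!expRD; congr (_ * expR _); ring.
rewrite /=; apply: ler_pM.
- by rewrite mulr_ge0 ?expR_ge0// ltW.
- exact: expR_ge0.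
- rewrite /A [H^-1 * _]mulrC; apply: le_trans (avg_expR_ge _ h0 _ _) _ => //.
  by rewrite lerD2r; apply: le_avg => x _; exact: qh.
- rewrite expRN lef_pV2 ?posrE ?expR_gt0 ?expR_ge1Dx//.
  by rewrite ltr_pwDl.
Qed.

(** * Hyperbolic cosine *)

Definition coshR (R : realType) (x : R) : R := (expR x + expR (- x)) / 2.

Section coshR.
Context (R : realType).
Implicit Types x y : R.

Lemma coshRN x : coshR (- x) = coshR x.
Proof. by rewrite /coshR opprK addrC. Qed.

Lemma coshR_norm x : coshR `|x| = coshR x.
Proof. by have [x0|x0] := ger0P x; rewrite ?coshRN. Qed.

Lemma coshR0 : coshR (0 : R) = 1.
Proof. by rewrite /coshR oppr0 expR0; lra. Qed.

Lemma ler_coshR x y : `|x| <= `|y| -> coshR x <= coshR y.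
Proof.
rewrite -(coshR_norm x) -(coshR_norm y); move: `|x| (normr_ge0 x) => {}x x0 xy.
move: `|y| xy => {}y xy.
rewrite /coshR ler_pM2r ?invr_gt0// -subr_ge0.
have -> : expR y + expR (- y) - (expR x + expR (- x)) =
    (expR y - expR x) * (1 - expR (- x) * expR (- y)).
  rewrite !expRN; field; by rewrite !gt_eqF ?expR_gt0.
rewrite mulr_ge0// subr_ge0 ?ler_expR// -expRD -expR0 ler_expR.
by rewrite -opprD oppr_le0 addr_ge0// (le_trans x0).
Qed.

Lemma coshR_ge1 x : 1 <= coshR x.
Proof. by rewrite -coshR0 ler_coshR// normr0. Qed.

Lemma coshRD x y : coshR (x + y) + coshR (x - y) = 2 * (coshR x * coshR y).
Proof.
rewrite /coshR opprD opprB !expRD !expRN; field.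
by rewrite !gt_eqF ?expR_gt0.
Qed.

Lemma coshR_double x : coshR (x *+ 2) = 1 + (expR x - expR (- x)) ^+ 2 / 2.
Proof.
rewrite /coshR mulr2n opprD !expRD !expRN; field.
by rewrite !gt_eqF ?expR_gt0.
Qed.

Lemma expR_ge_quadratic x : 0 <= x -> 1 + x + x ^+ 2 / 2 <= expR x.
Proof.
move=> x0.
have -> : 1 + x + x ^+ 2 / 2 = series (exp_coeff x) 3.
  by rewrite /series /= !big_nat_recr//= big_geq// /exp_coeff /=
    expr0 expr1 !divr1 add0r (_ : 2`! = 2)%N.
apply: nondecreasing_cvgn_le; last exact: is_cvg_series_exp_coeff.
by apply: nondecreasing_series => n _ _; exact: exp_coeff_ge0.
Qed.

Lemma coshR_ge x : 1 + x ^+ 2 / 2 <= coshR x.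
Proof.
rewrite -(coshR_norm x) -(real_normK (num_real x)).
move: `|x| (normr_ge0 x) => {}x x0; pose u := x / 2.
have u0 : 0 <= u by rewrite divr_ge0.
rewrite (_ : x = u *+ 2); last by rewrite -mulr_natr divfK.
rewrite coshR_double lerD2l ler_pM2r ?invr_gt0//.
rewrite ler_pXn2r ?nnegrE ?mulrn_wge0//; last first.
  by rewrite subr_ge0 ler_expR; lra.
(* With q the quadratic Taylor polynomial, q - 1/q >= 2u since q^2 - 1 - 2uq = u^4/4. *)
pose q := 1 + u + u ^+ 2 / 2.
have q0 : 0 < q by rewrite /q; have := sqr_ge0 u; lra.
have uq : q <= expR u by exact: expR_ge_quadratic.
have : expR (- u) <= q^-1 by rewrite expRN lef_pV2 ?posrE ?expR_gt0.
suff : u *+ 2 <= q - q^-1 by lra.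
rewrite -(ler_pM2r q0) mulrBl mulVf ?gt_eqF// -subr_ge0.
suff -> : q * q - 1 - u *+ 2 * q = (u ^+ 2 / 2) ^+ 2 by exact: sqr_ge0.
by rewrite /q; field.
Qed.

Lemma coshR_le x : `|x| < 2 -> coshR x <= 1 + x ^+ 2 / 2 / (1 - `|x| / 2) ^+ 2.
Proof.
rewrite -(coshR_norm x) -(real_normK (num_real x)).
move: `|x| (normr_ge0 x) => {}x x0 x2; pose u := x / 2.
have u0 : 0 <= u by rewrite divr_ge0.
have u1 : 0 < 1 - u by rewrite /u; lra.
have -> : x ^+ 2 / 2 / (1 - x / 2) ^+ 2 = (2 * (u / (1 - u))) ^+ 2 / 2.
  by rewrite -/u (_ : x = u * 2); [field; rewrite gt_eqF|rewrite /u divfK].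
rewrite [in coshR _](_ : x = u *+ 2); last by rewrite -mulr_natr divfK.
rewrite coshR_double lerD2l ler_pM2r ?invr_gt0//.
rewrite ler_pXn2r ?nnegrE//; last 2 first.
  by rewrite subr_ge0 ler_expR; lra.
  by rewrite mulr_ge0// divr_ge0// ltW.
have h1 : 1 - u <= expR (- u) by rewrite expR_ge1Dx.
have h2 : expR u <= (1 - u)^-1.
  by rewrite -[expR u]invrK -expRN lef_pV2 ?posrE ?expR_gt0.
apply: le_trans (lerB h2 h1) _.
rewrite -subr_ge0 (_ : _ - _ = u ^+ 2 / (1 - u)); last by field; rewrite gt_eqF.
by rewrite divr_ge0 ?sqr_ge0// ltW.
Qed.

End coshR.

(** * A walk that charges each slab only once *)

Definition height (R : realType) d (l : 'rV[R]_d) (y : 'Zd_d) : R :=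
  \sum_(i < d) (y 0 i)%:~R * l 0 i.

Definition level (R : realType) d (l : 'rV[R]_d) (L : R) (j : int) (x : 'Zd_d) : int :=
  if j%:~R * L < height l x then j else j - 1.

Definition slab (R : realType) d (l : 'rV[R]_d) (L : R) (j : int) (y : 'Zd_d) : bool :=
  j%:~R * L < height l y <= (j + 1)%:~R * L.

(** The recursion of [greenN] for a walk carrying a level [j] that drops by one
    when the height falls to [j * L], and which feels the potential only inside
    the slab of its current level.  A level that has been left is never entered
    again, so a site is charged a number of times which is on average of order [L],
    in every dimension and for every potential. *)
Fixpoint levelN (R : realType) d (l : 'rV[R]_d) (L : R) (U : 'Zd_d -> R)
    (n : nat) (j : int) (y : 'Zd_d) : R :=
  if n is m.+1 then
    (avg (fun x => levelN l L U m (level l L j x) x) y + (y == 0)%:R) /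
    (1 + if slab l L j y then U y else 0)
  else 0.

Section height.
Context (R : realType) (d : nat) (l : 'rV[R]_d).

Lemma heightD x y : height l (x + y) = height l x + height l y.
Proof.
by rewrite /height -big_split; apply: eq_bigr => i _; rewrite mxE rmorphD mulrDl.
Qed.

Lemma height0 : height l 0 = 0.
Proof. by rewrite /height big1// => i _; rewrite mxE mul0r. Qed.

Lemma heightN x : height l (- x) = - height l x.
Proof. by apply/eqP; rewrite -addr_eq0 -heightD addNr height0. Qed.

Lemma height_delta i : height l (delta_mx 0 i) = l 0 i.
Proof.
rewrite /height (bigD1 i)//= big1 ?addr0; first by rewrite mxE !eqxx mul1r.
by move=> k /negbTE ki; rewrite mxE eqxx ki mul0r.
Qed.

Lemma heightMn x k : height l (x *+ k) = k%:R * height l x.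
Proof.
elim: k => [|k IH]; first by rewrite mulr0n height0 mul0r.
by rewrite mulrSr heightD IH -natr1 mulrDl mul1r.
Qed.

End height.

Section leveled.
Context (R : realType) (d : nat) (l : 'rV[R]_d) (L : R).
Hypothesis d0 : (0 < d)%N.
Hypothesis l_unit : \sum_(i < d) l 0 i ^+ 2 = 1.
Hypothesis L1 : 1 <= L.
Local Notation s := (height l).
Local Notation level := (level l L).
Local Notation slab := (slab l L).
Local Notation levelN := (levelN l L).
Implicit Types (U : 'Zd_d -> R) (x y z : 'Zd_d) (j k : int) (n : nat).

Lemma unit_coord_le1 i : `|l 0 i| <= 1.
Proof.
rewrite -(ler_pXn2r (_ : 0 < 2)%N) ?nnegrE// real_normK ?num_real// expr1n -l_unit.
by rewrite (bigD1 i)//= lerDl sumr_ge0// => k _; exact: sqr_ge0.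
Qed.

Lemma unit_sum_norm_ge1 : 1 <= \sum_(i < d) `|l 0 i|.
Proof.
rewrite -l_unit; apply: ler_sum => i _.
by rewrite -real_normK ?num_real// expr2 ler_piMl// unit_coord_le1.
Qed.

Lemma height_neighbour y x : neighbour y x -> `|s x - s y| <= 1.
Proof.
by case=> i [->|->]; rewrite heightD ?heightN height_delta addrAC subrr add0r
  ?normrN unit_coord_le1.
Qed.

Lemma level_height j y x : neighbour y x -> j%:~R * L < s y ->
  (level j x)%:~R * L < s x.
Proof.
move=> /height_neighbour; rewrite ler_norml => /andP[yx _] jy; rewrite /level.
case: ifPn => [//|_]; rewrite rmorphB rmorph1 mulrBl mul1r; have := L1; lra.
Qed.

Section nonneg_potential.
Variable U : 'Zd_d -> R.
Hypothesis U0 : forall y, 0 <= U y.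

Lemma slab_charge_gt0 j y : 0 < 1 + if slab j y then U y else 0.
Proof. by rewrite ltr_pwDl//; case: ifP. Qed.

Lemma levelN_ge0 n j y : 0 <= levelN U n j y.
Proof.
elim: n j y => [|n IH] j y //=.
by rewrite divr_ge0 ?(ltW (slab_charge_gt0 _ _))// addr_ge0// avg_ge0.
Qed.

Lemma levelN_leS n j y : levelN U n j y <= levelN U n.+1 j y.
Proof.
elim: n j y => [|n IH] j y; first exact: (levelN_ge0 1).
rewrite [leLHS]/= [leRHS]/= ler_pM2r ?invr_gt0 ?slab_charge_gt0// lerD2r.
exact: le_avg.
Qed.

Lemma levelN_nondecreasing j y : {homo (fun n => levelN U n j y) : m n / (m <= n)%N >-> m <= n}.
Proof. by apply/nondecreasing_seqP => n; exact: levelN_leS. Qed.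

Lemma levelN_le n j y : levelN U n j y <= n%:R.
Proof.
elim: n j y => [|n IH] j y //=.
rewrite ler_pdivrMr ?slab_charge_gt0//; apply: (@le_trans _ _ (n%:R + 1)).
  rewrite lerD ?lern1 ?leq_b1// -(avg_cst n%:R y d0); exact: le_avg.
by rewrite natr1 ler_peMr// lerDl; case: ifP.
Qed.

End nonneg_potential.

Lemma levelN_anti U U' : (forall y, 0 <= U y) -> (forall y, U y <= U' y) ->
  forall n j y, levelN U' n j y <= levelN U n j y.
Proof.
move=> U0 UU'; have U'0 y : 0 <= U' y by apply: le_trans (UU' y).
elim=> [|n IH] j y //=; apply: ler_pM.
- by rewrite addr_ge0// avg_ge0// => x _; exact: levelN_ge0.
- by rewrite invr_ge0 ltW// slab_charge_gt0.
- by rewrite lerD2r; apply: le_avg.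
- by rewrite lef_pV2 ?posrE ?slab_charge_gt0// lerD2l; case: ifP.
Qed.

(** Both sides sum over the same walks, which [levelN] charges at fewer sites. *)
Lemma greenN_le_levelN U V : (forall y, 0 <= U y) -> (forall y, U y <= V y) ->
  forall n j y, greenN V n y <= levelN U n j y.
Proof.
move=> U0 UV; have V0 y : 0 <= V y by apply: le_trans (UV y).
elim=> [|n IH] j y //=; apply: ler_pM.
- by rewrite addr_ge0// avg_ge0// => x _; exact: greenN_ge0.
- by rewrite invr_ge0 addr_ge0.
- by rewrite lerD2r; apply: le_avg.
- rewrite lef_pV2 ?posrE ?slab_charge_gt0//; last by rewrite ltr_pwDl.
  by rewrite lerD2l; case: ifP.
Qed.

(** Averaging over a pair of opposite neighbours lowers a concave function of the
    height; at the kink [z] the total loss is the sum of the [`|l 0 i|], which is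
    at least [1] for a unit vector. *)
Lemma avg_min_height y z :
  avg (fun x => Num.min (s x) (s z)) y + (y == z)%:R / (2 * d)%:R <= Num.min (s y) (s z).
Proof.
have d2 : 0 < (2 * d)%:R :> R by rewrite ltr0n muln_gt0.
rewrite -(ler_pM2l d2) mulrDr /avg mulrA divff ?gt_eqF// mul1r mulrCA divff ?gt_eqF// mulr1.
rewrite (_ : _%:R * _ = \sum_(i < d) (2 * Num.min (s y) (s z))); last first.
  by rewrite sumr_const card_ord natrM -mulr_natr; ring.
apply: (@le_trans _ _ (\sum_(i < d) (2 * Num.min (s y) (s z) - (y == z)%:R * `|l 0 i|)
                       + (y == z)%:R)).
  rewrite lerD2r; apply: ler_sum => i _.
  rewrite !heightD heightN height_delta.
  have [->|_] := eqVneq y z; rewrite ?mul1r ?mul0r; last first.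
    by rewrite /Num.min; do !case: ifPn; rewrite -?leNgt; lra.
  have [l0|l0] := ger0P (l 0 i); rewrite /Num.min; do !case: ifPn; rewrite -?leNgt; lra.
rewrite sumrB -addrA gerDl -mulr_sumr addrC subr_le0 ler_peMr//.
exact: unit_sum_norm_ge1.
Qed.

(** Twice [d] times the distance to the exit level bounds the Green's function
    at [z] of the walk killed when it leaves level [j]: this is the one
    quantitative input on the walk, and it is the same in every dimension. *)
Definition exit_barrier j z k x : R :=
  if k == j then (2 * d)%:R * (Num.min (s x) (s z) - j%:~R * L + 1) else 0.

Lemma avg_exit_barrier j z k y : k <= j -> j%:~R * L < s z -> k%:~R * L < s y ->
  avg (fun x => exit_barrier j z (level k x) x) y + ((k == j) && (y == z))%:R
    <= exit_barrier j z k y.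
Proof.
move=> kj jz ky; have d2 : 0 < (2 * d)%:R :> R by rewrite ltr0n muln_gt0.
have [kjE|kjN] := eqVneq k j; last first.
  rewrite addr0 /exit_barrier (negbTE kjN) -[leRHS](avg_cst 0 y d0).
  apply: le_avg => x _; case: ifPn => // /eqP; rewrite /level.
  have {}kj : k < j by rewrite lt_neqAle kjN.
  by case: ifP => _ E; move: kj; rewrite -E; [rewrite ltxx|rewrite ltNge gerBl].
subst k; rewrite {2}/exit_barrier eqxx/=.
apply: (@le_trans _ _ (avg (fun x => (2 * d)%:R *
    (Num.min (s x) (s z) + (1 - j%:~R * L))) y + (y == z)%:R)).
  rewrite lerD2r; apply: le_avg => x /height_neighbour; rewrite ler_norml => /andP[yx _].
  rewrite /exit_barrier; case: ifPn => _; first by rewrite -addrA (addrC 1).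
  rewrite mulr_ge0//; have : j%:~R * L - 1 < Num.min (s x) (s z) by rewrite lt_min; lra.
  by lra.
rewrite avgZ avgD avg_cst//; have := avg_min_height y z.
rewrite -(ler_pM2l d2) mulrDr [X in _ + X <= _]mulrCA divff ?gt_eqF// mulr1; lra.
Qed.

Lemma exit_barrier_ge0 j z k x : k%:~R * L - 1 < s x -> j%:~R * L < s z ->
  0 <= exit_barrier j z k x.
Proof.
move=> kx jz; rewrite /exit_barrier; case: ifPn => [/eqP kj|//]; subst k.
rewrite mulr_ge0//; have : j%:~R * L - 1 < Num.min (s x) (s z) by rewrite lt_min; lra.
by lra.
Qed.

Lemma exit_barrier_diag j z : slab j z -> exit_barrier j z j z <= (2 * d)%:R * (L + 1).
Proof.
move=> /andP[_ zj]; rewrite /exit_barrier eqxx minxx ler_wpM2l//.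
by move: zj; rewrite rmorphD rmorph1 mulrDl mul1r; lra.
Qed.

(** Switching on the potential at one site [z] lowers the value at [z] itself by
    a relative amount of at most the potential times the Green's function of the
    walk killed outside its level; the loss is propagated by the walk and
    dominated by the barrier. *)
Lemma levelN_single_site U U' j z n :
  (forall y, 0 <= U y) -> (forall y, y != z -> U' y = U y) -> U' z = 0 -> slab j z ->
  levelN U' n j z - levelN U n j z <= U z * ((2 * d)%:R * (L + 1)) * levelN U' n j z.
Proof.
move=> U0 U'E U'z zj; have /andP[jz _] := zj.
have U'0 y : 0 <= U' y by have [->|yz] := eqVneq y z; rewrite ?U'z ?U'E.
have U'U y : U' y <= U y by have [->|yz] := eqVneq y z; rewrite ?U'z ?U'E.
pose A := U z * levelN U' n j z.
have A0 : 0 <= A by rewrite mulr_ge0// levelN_ge0.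
suff H m k x : (m <= n)%N -> k <= j -> k%:~R * L < s x ->
    levelN U' m k x - levelN U m k x <= A * exit_barrier j z k x.
  apply: le_trans (H n j z (leqnn n) (lexx j) jz) _.
  rewrite (_ : U z * _ * _ = A * ((2 * d)%:R * (L + 1))); last by rewrite /A; ring.
  by rewrite ler_wpM2l// exit_barrier_diag.
elim: m k x => [|m IH] k x mn kj kx.
  by rewrite /= subr0 mulr_ge0// exit_barrier_ge0//; lra.
pose X' := avg (fun y => levelN U' m (level k y) y) x + (x == 0)%:R.
pose X := avg (fun y => levelN U m (level k y) y) x + (x == 0)%:R.
have XX' : X' - X <= A * avg (fun y => exit_barrier j z (level k y) y) x.
  rewrite /X' /X opprD addrACA subrr addr0 -avgB -avgZ; apply: le_avg => y xy.
  apply: (IH _ _ (ltnW mn)); last exact: level_height kx.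
  by rewrite /level; case: ifP => // _; rewrite (le_trans _ kj)// gerBl.
have X_X' : X <= X'.
  by rewrite lerD2r; apply: le_avg => y _; exact: levelN_anti.
have := avg_exit_barrier kj jz kx => B.
apply: (@le_trans _ _ (A * (avg (fun y => exit_barrier j z (level k y) y) x
                           + ((k == j) && (x == z))%:R))); last exact: ler_wpM2l.
rewrite [levelN U' _ _ _]/= [levelN U _ _ _]/= -/X' -/X mulrDr.
have [/andP[/eqP kE /eqP xE]|kx_neq] := boolP ((k == j) && (x == z)).
  subst k x; rewrite zj U'z addr0 divr1 mulr1.
  have Xle : X / (1 + U z) <= levelN U' n j z.
    have -> : X / (1 + U z) = levelN U m.+1 j z by rewrite /= zj.
    apply: le_trans (levelN_anti U'0 U'U _ _ _) _.
    exact: levelN_nondecreasing.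
  have -> : X' - X / (1 + U z) = (X' - X) + U z * (X / (1 + U z)).
    by field; rewrite gt_eqF// ltr_pwDl.
  by apply: lerD => //; rewrite ler_wpM2l.
have -> : (if slab k x then U' x else 0) = (if slab k x then U x else 0).
  case: ifP => // kx'; apply: U'E; apply: contra kx_neq => /eqP xE; subst x.
  rewrite eqxx andbT; rewrite eq_le kj/= -ltzD1 -(@ltr_int R).
  case/andP: kx' => _ kz; case/andP: zj => zj _.
  by rewrite -(@ltr_pM2r _ L) ?(lt_le_trans zj)// (lt_le_trans _ L1).
rewrite -mulrBl mulr0 addr0 ler_pdivrMr ?slab_charge_gt0//.
apply: (le_trans XX'); rewrite ler_peMr//; last by rewrite lerDl; case: ifP.
by apply: le_trans XX'; rewrite subr_ge0.
Qed.

End leveled.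

(** * A supersolution decaying by a fixed factor per slab *)

(** A supersolution for constant killing inside a slab of width [L]; it is flat
    from height [L - 1] on, so that a walk above the slab, which is not killed,
    sees a constant. *)
Definition profile (R : realType) (theta L t : R) : R :=
  coshR (theta * Num.max (L - 1 - t) 0).

Section supersolution.
Context (R : realType) (d : nat) (l : 'rV[R]_d) (L theta a : R).
Hypothesis d0 : (0 < d)%N.
Hypothesis l_unit : \sum_(i < d) l 0 i ^+ 2 = 1.
Hypothesis L1 : 1 < L.
Hypothesis theta0 : 0 < theta.
Hypothesis a0 : 0 <= a.
Hypothesis cosh_a : \sum_(i < d) coshR (theta * l 0 i) <= d%:R * (1 + a).
Local Notation s := (height l).
Local Notation level := (level l L).
Local Notation slab := (slab l L).
Implicit Types (x y z : 'Zd_d) (j k : int) (n : nat).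

Let L_ge1 : 1 <= L.
Proof. exact: ltW. Qed.

Definition slab_gain : R := coshR (theta * (L - 1)).

Definition source_size : R := (2 * d)%:R * (L + 1) / (slab_gain - 1).

(** Every level below the source contributes at most the exit barrier of its
    slab.  Dropping by a level multiplies the profile by [slab_gain], and
    [source_size] is the amplitude for which the sum of these contributions
    reproduces itself from one level to the next. *)
Definition amplitude j : R :=
  if j is Posz n then source_size / slab_gain ^+ n else source_size.

(** The profile pays for the killing, the exit barrier for the source at [0],
    which is met only on the levels below it. *)
Definition level_bound j y : R :=
  amplitude j * profile theta L (s y - j%:~R * L) +
  if j < 0 then exit_barrier l L j 0 j y else 0.

Lemma slab_gain_gt1 : 1 < slab_gain.
Proof.
apply: lt_le_trans (coshR_ge _); rewrite ltrDl divr_gt0// exprn_gt0// mulr_gt0//.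
by rewrite subr_gt0.
Qed.

Let gain0 : 0 < slab_gain.
Proof. exact: lt_trans slab_gain_gt1. Qed.

Lemma source_size_gt0 : 0 < source_size.
Proof.
rewrite divr_gt0 ?subr_gt0 ?slab_gain_gt1// mulr_gt0//; last by have := L1; lra.
by rewrite ltr0n muln_gt0.
Qed.

Lemma amplitude_gt0 j : 0 < amplitude j.
Proof.
case: j => n /=; last exact: source_size_gt0.
by apply: divr_gt0; [exact: source_size_gt0|exact: exprn_gt0].
Qed.

Lemma amplitude_drop j :
  amplitude (j - 1) + (if j - 1 < 0 then (2 * d)%:R * (L + 1) else 0) <=
  slab_gain * amplitude j.
Proof.
have fixpoint : source_size + (2 * d)%:R * (L + 1) <= slab_gain * source_size.
  rewrite -subr_ge0 le_eqVlt; apply/orP; left; apply/eqP.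
  by rewrite /source_size; field; rewrite gt_eqF ?subr_gt0 ?slab_gain_gt1.
case: j => [[|n]|n]; [rewrite [amplitude 0]/= expr0 divr1; exact: fixpoint| |].
  rewrite (_ : Posz n.+1 - 1 = n); last by rewrite -addn1 PoszD addrK.
  rewrite addr0 /= exprS invfM mulrCA [slab_gain * _]mulrA divff ?gt_eqF// mul1r.
  exact: lexx.
rewrite (_ : Negz n - 1 = Negz n.+1); last by rewrite !NegzE -opprD -PoszD addn1.
exact: fixpoint.
Qed.

Lemma avg_profile j y :
  avg (fun x => profile theta L (s x - j%:~R * L)) y <=
  (1 + if s y <= (j + 1)%:~R * L then a else 0) * profile theta L (s y - j%:~R * L).
Proof.
have d2 : 0 < (2 * d)%:R :> R by rewrite ltr0n muln_gt0.
have jL : (j + 1)%:~R * L = j%:~R * L + L by rewrite rmorphD rmorph1 mulrDl mul1r.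
rewrite -(ler_pM2l d2) /avg mulrA divff ?gt_eqF// mul1r.
set t := s y - j%:~R * L; set r := Num.max (L - 1 - t) 0.
have sumE i : profile theta L (s (y + delta_mx 0 i) - j%:~R * L) +
    profile theta L (s (y - delta_mx 0 i) - j%:~R * L) =
    profile theta L (t + l 0 i) + profile theta L (t - l 0 i).
  by rewrite !heightD heightN height_delta /t; congr (_ + _); congr (profile _ _ _); ring.
case: ifPn => [yj|]; last first.
  rewrite -ltNge jL => yj; rewrite addr0 mul1r.
  have one t' : L - 1 < t' -> profile theta L t' = 1.
    by move=> t'L; rewrite /profile max_r ?mulr0 ?coshR0//; lra.
  rewrite one; last by rewrite /t; lra.
  rewrite mulr1 (eq_bigr (fun=> 2)) => [|i _].
    by rewrite sumr_const card_ord -mulrnA.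
  have := unit_coord_le1 l_unit i; rewrite ler_norml => /andP[l1 l2].
  by rewrite sumE !one//; rewrite /t; lra.
apply: (@le_trans _ _ (\sum_(i < d) 2 * (coshR (theta * r) * coshR (theta * l 0 i)))).
  apply: ler_sum => i _; rewrite sumE -coshRD addrC.
  have closer (u v : R) : Num.max (u - v) 0 <= `|Num.max u 0 - v|.
    rewrite ge_max normr_ge0 andbT; apply: le_trans (ler_norm _).
    by rewrite lerD2r le_max lexx.
  rewrite -!mulrDr -mulrBr; apply: lerD; apply: ler_coshR.
    rewrite !normrM ler_wpM2l// ger0_norm ?le_max ?lexx ?orbT//.
    have := closer (L - 1 - t) (- l 0 i); rewrite opprK; apply: le_trans.
    by rewrite opprD opprK addrA.
  rewrite !normrM ler_wpM2l// ger0_norm ?le_max ?lexx ?orbT//.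
  have := closer (L - 1 - t) (l 0 i); apply: le_trans.
  by rewrite opprD addrA.
rewrite -mulr_sumr -mulr_sumr.
have -> : (2 * d)%:R * ((1 + a) * profile theta L t) =
    2 * (coshR (theta * r) * (d%:R * (1 + a))) by rewrite natrM /profile -/r; ring.
by rewrite ler_wpM2l// ler_wpM2l// (le_trans _ (coshR_ge1 _)).
Qed.

Lemma profile_entry t : L - 1 < t -> profile theta L t = 1.
Proof. by move=> tL; rewrite /profile max_r ?mulr0 ?coshR0//; lra. Qed.

Lemma profile_exit t : t <= 0 -> slab_gain <= profile theta L t.
Proof.
move=> t0; apply: ler_coshR; rewrite !normrM ler_wpM2l// ger0_norm ?subr_ge0//.
by rewrite ger0_norm ?le_max ?lexx ?orbT//; apply/orP; left; lra.
Qed.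

Lemma profile_le t : 0 <= t -> profile theta L t <= slab_gain.
Proof.
move=> t0; apply: ler_coshR; rewrite !normrM ler_wpM2l//.
rewrite [leRHS]ger0_norm ?subr_ge0// ger0_norm ?le_max ?lexx ?orbT//.
by rewrite ge_max subr_ge0 L_ge1 andbT; lra.
Qed.

Lemma profile_ge0 t : 0 <= profile theta L t.
Proof. exact: le_trans (coshR_ge1 _). Qed.

Lemma level_bound_ge0 j y : j%:~R * L < s y -> 0 <= level_bound j y.
Proof.
move=> jy; apply: addr_ge0.
  by apply: mulr_ge0; [exact/ltW/amplitude_gt0|exact: profile_ge0].
case: ifPn => // j0; apply: exit_barrier_ge0; first by lra.
by rewrite height0 nmulr_rlt0 ?ltrz0// (lt_trans _ L1).
Qed.

(** Where the walk drops by one level, the new profile starts from [1] while the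
    old one has reached [slab_gain]: the amplitudes are chosen to absorb the
    difference. *)
Lemma level_bound_next j y x : neighbour y x -> j%:~R * L < s y ->
  level_bound (level j x) x <=
  amplitude j * profile theta L (s x - j%:~R * L) +
  if j < 0 then exit_barrier l L j 0 j x else 0.
Proof.
move=> yx jy; have jx := level_height l_unit L_ge1 yx jy.
move: jx; rewrite /level; case: ifPn => // xj jx.
have LN0 k : k < 0 -> k%:~R * L < s 0.
  by move=> k0; rewrite height0 nmulr_rlt0 ?ltrz0// (lt_trans _ L1).
have := height_neighbour l_unit yx; rewrite ler_norml => /andP[yx1 _].
move: xj; rewrite -leNgt => xj.
have jL : (j - 1)%:~R * L = j%:~R * L - L by rewrite rmorphB rmorph1 mulrBl mul1r.
rewrite /level_bound jL profile_entry ?mulr1; last by have := L1; lra.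
apply: (@le_trans _ _ (amplitude (j - 1) +
    (if j - 1 < 0 then (2 * d)%:R * (L + 1) else 0))).
  rewrite lerD2l; case: ifPn => // j0.
  rewrite /exit_barrier eqxx ler_wpM2l// jL.
  have : Num.min (s x) (s 0) <= s x by rewrite ge_min lexx.
  by lra.
apply: le_trans (amplitude_drop j) _; rewrite -[leLHS]addr0; apply: lerD.
  rewrite [leLHS]mulrC; apply: ler_wpM2l; first exact/ltW/amplitude_gt0.
  by apply: profile_exit; lra.
case: ifPn => // j0; apply: exit_barrier_ge0; last exact: LN0.
by lra.
Qed.

Lemma level_bound_super j y : j%:~R * L < s y ->
  avg (fun x => level_bound (level j x) x) y + (y == 0)%:R <=
  (1 + if slab j y then a else 0) * level_bound j y.
Proof.
move=> jy; pose ch := if slab j y then a else 0 : R.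
have ch0 : 0 <= ch by rewrite /ch; case: ifP.
have LN0 k : k < 0 -> k%:~R * L < s 0.
  by move=> k0; rewrite height0 nmulr_rlt0 ?ltrz0// (lt_trans _ L1).
apply: (@le_trans _ _ (avg (fun x => amplitude j * profile theta L (s x - j%:~R * L) +
  if j < 0 then exit_barrier l L j 0 j x else 0) y + (y == 0)%:R)).
  by rewrite lerD2r; apply: le_avg => x yx; exact: (level_bound_next yx jy).
rewrite avgD avgZ -addrA /level_bound mulrDr; apply: lerD.
  rewrite [leRHS]mulrCA; apply: ler_wpM2l; first exact/ltW/amplitude_gt0.
  by have := avg_profile j y; rewrite /slab jy.
have [j0|j0] := ltP j 0; last first.
  rewrite avg_cst// mulr0 add0r; have [yE|//] := eqVneq y 0.
  move: jy; rewrite yE height0 ltNge mulr_ge0//; last by rewrite ltW// (lt_trans _ L1).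
  by rewrite ler0z.
apply: (@le_trans _ _ (exit_barrier l L j 0 j y)); last first.
  by rewrite ler_peMl ?lerDl// exit_barrier_ge0 ?LN0//; lra.
have d2 : 0 < (2 * d)%:R :> R by rewrite ltr0n muln_gt0.
have -> : avg (fun x => exit_barrier l L j 0 j x) y =
    (2 * d)%:R * (avg (fun x => Num.min (s x) (s 0)) y + (1 - j%:~R * L)).
  rewrite -[X in _ * (_ + X)](avg_cst _ y d0) -avgD -avgZ.
  by apply: eq_avg => x _; rewrite /exit_barrier eqxx; ring.
rewrite /exit_barrier eqxx; have := avg_min_height d0 l_unit y 0.
rewrite -(ler_pM2l d2) mulrDr [X in _ + X <= _]mulrCA divff ?gt_eqF// mulr1; lra.
Qed.

End supersolution.

(** * Independence of one site from the others *)

Section measurability.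
Context (dT : measure_display) (T : measurableType dT) (R : realType).

Lemma measurable_avg d (f : 'Zd_d -> T -> R) y :
  (forall x, measurable_fun setT (f x)) -> measurable_fun setT (fun w => avg (f ^~ w) y).
Proof.
move=> mf; apply: measurable_funM; first exact: measurable_cst.
by apply: measurable_sum => i; exact: measurable_funD.
Qed.

Lemma measurable_inv1D (u : T -> R) : (forall w, 0 <= u w) ->
  measurable_fun setT u -> measurable_fun setT (fun w => (1 + u w)^-1).
Proof.
move=> u0 mu; rewrite (_ : (fun _ => _) = (fun t : R => (1 + `|t|)^-1) \o u).
  apply: measurableT_comp => //; apply: continuous_measurable_fun => t.
  apply: cvgV; first by rewrite gt_eqF// ltr_pwDl.
  by apply: cvgD; [exact: cvg_cst|exact: norm_continuous].
by apply/funext => w /=; rewrite ger0_norm.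
Qed.

Context (d : nat) (U : 'Zd_d -> T -> R).
Hypothesis U0 : forall x w, 0 <= U x w.
Hypothesis mU : forall x, measurable_fun setT (U x).

Lemma measurable_greenN n y : measurable_fun setT (fun w => greenN (U ^~ w) n y).
Proof.
elim: n y => [|n IH] y; first exact: measurable_cst.
apply: measurable_funM; last exact: measurable_inv1D.
by apply: measurable_funD; [exact: measurable_avg|exact: measurable_cst].
Qed.

Lemma measurable_levelN l L n j y :
  measurable_fun setT (fun w => levelN l L (U ^~ w) n j y).
Proof.
elim: n j y => [|n IH] j y; first exact: measurable_cst.
apply: measurable_funM.
  apply: measurable_funD; last exact: measurable_cst.
  by apply: (@measurable_avg d (fun x w => levelN l L (U ^~ w) n (level l L j x) x)).
by case: (slab l L j y); apply: measurable_inv1D.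
Qed.

End measurability.

Section independence.
Context (dT : measure_display) (T : measurableType dT) (R : realType).
Variable P : probability T R.
Local Open Scope ereal_scope.

(** The joint law is the product of the laws, and Tonelli's theorem applies. *)
Lemma independent_integralM (Y Z : {RV P >-> R}) :
  (forall w, 0 <= Y w)%R -> (forall w, 0 <= Z w)%R ->
  (forall A B, measurable A -> measurable B ->
    P (Y @^-1` A `&` Z @^-1` B) = P (Y @^-1` A) * P (Z @^-1` B)) ->
  \int[P]_w (Y w * Z w)%:E = (\int[P]_w (Y w)%:E) * (\int[P]_w (Z w)%:E).
Proof.
move=> Y0 Z0 YZ.
have mYZ : measurable_fun setT (fun w => (Y w, Z w)) by exact: measurable_fun_pair.
pose pair_mixin := isMeasurableFun.Build _ _ _ _ _ mYZ.
pose W : {mfun T >-> (R * R)%type} := HB.pack (fun w => (Y w, Z w)) pair_mixin.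
pose nn (z : R) : \bar R := `|z|%:E.
have mnn : measurable_fun setT nn by apply/measurable_EFinP; exact: normr_measurable.
pose f (z : R * R) : \bar R := nn z.1 * nn z.2.
have mf : measurable_fun setT f.
  by apply: emeasurable_funM; apply: measurableT_comp.
have nn0 z : 0 <= nn z by rewrite lee_fin.
have f0 z : 0 <= f z by rewrite mule_ge0.
transitivity (\int[distribution P W]_z f z).
  rewrite ge0_integral_distribution//; apply: eq_integral => w _ /=.
  by rewrite /f /nn/= !ger0_norm// EFinM.
transitivity (\int[distribution P Y \x distribution P Z]_z f z).
  apply: eq_measure_integral => A mA _; apply/esym.

  apply: (@product_measure_unique _ _ _ _ _ (distribution P Y) (distribution P Z) (distribution P W)) => //.
rewrite fubini_tonelli1//.
transitivity (\int[distribution P Y]_y (nn y * \int[distribution P Z]_z nn z)).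
  by apply: eq_integral => y _; rewrite /fubini_F /f/= ge0_integralZl.
under eq_integral do rewrite muleC.
rewrite ge0_integralZl//; last by apply: integral_ge0 => z _.
rewrite muleC !ge0_integral_distribution//; congr (_ * _); apply: eq_integral => w _.
  by rewrite /nn/= ger0_norm.
by rewrite /nn/= ger0_norm.
Qed.

Context (I : choiceType) (X : I -> {RV P >-> R}).
Hypothesis indX : mutually_independent X.
Variable i : I.

Definition cylinder_off : set (set T) :=
  [set A | exists (s : seq I) (B : I -> set R),
    [/\ uniq s, i \notin s, forall k, measurable (B k) &
        A = \bigcap_(k in [set` s]) (X k @^-1` B k)]].

Lemma cylinder_off_setI : setI_closed cylinder_off.
Proof.
move=> _ _ [s [B [us si mB ->]]] [t [C [ut ti mC ->]]].
exists (undup (s ++ t)), (fun k => (if k \in s then B k else setT) `&`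
                                   (if k \in t then C k else setT)); split.
- exact: undup_uniq.
- by rewrite mem_undup mem_cat negb_or si.
- by move=> k; apply: measurableI; case: ifP.
apply/seteqP; split => [w [Bw Cw] k _|w BCw]; last split => k /= ks.
- by split; case: ifPn => // ks; [exact: Bw|exact: Cw].
- by have := BCw k; rewrite /= mem_undup mem_cat ks => /(_ isT)[].
- by have := BCw k; rewrite /= mem_undup mem_cat ks orbT => /(_ isT)[].
Qed.

Lemma cylinder_off_measurable : cylinder_off `<=` measurable.
Proof.
move=> _ [s [B [_ _ mB ->]]]; apply: fin_bigcap_measurable; first exact: finite_seq.
by move=> k _; rewrite -[_ @^-1` _]setTI; exact: measurable_funP.
Qed.

Lemma cylinder_off_independent A C : cylinder_off A -> measurable C ->
  P (A `&` X i @^-1` C) = P (X i @^-1` C) * P A.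
Proof.
move=> [s [B [us si mB ->]]] mC.
pose B' k := if k == i then C else B k.
have -> : \bigcap_(k in [set` s]) (X k @^-1` B k) =
    \bigcap_(k in [set` s]) (X k @^-1` B' k).
  apply: eq_bigcapr => k /= ks; rewrite /B'; case: eqP => // ki.
  by move: si; rewrite -ki ks.
have -> : \bigcap_(k in [set` s]) (X k @^-1` B' k) `&` X i @^-1` C =
    \bigcap_(k in [set` i :: s]) (X k @^-1` B' k).
  apply/seteqP; split => [w [sw iw] k /=|w sw].
    by rewrite inE => /predU1P[->|ks]; [rewrite /B' eqxx|exact: sw].
  split => [k /= ks|]; first by apply: sw; rewrite /= inE ks orbT.
  by have := sw i; rewrite /= mem_head /B' eqxx; exact.
have mB' k : measurable (B' k) by rewrite /B'; case: ifP.
rewrite !indX//=; last by rewrite si.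
by rewrite big_cons /B' eqxx.
Qed.

(** Both sides are finite measures in the event, and they agree on the cylinders,
    which are stable under intersection. *)
Lemma sigma_off_independent A C : <<s cylinder_off >> A -> measurable C ->
  P (X i @^-1` C `&` A) = P (X i @^-1` C) * P A.
Proof.
move=> sA mC; have mXC : measurable (X i @^-1` C).
  by rewrite -[_ @^-1` _]setTI; exact: measurable_funP.
have PC : P (X i @^-1` C) = (fine (P (X i @^-1` C)))%:E.
  by rewrite fineK// fin_num_measure.
have PC0 : (0 <= fine (P (X i @^-1` C)))%R by exact: fine_ge0.
rewrite setIC.
have := @g_sigma_algebra_measure_unique _ _ _ cylinder_off cylinder_off_measurable
  (fun=> setT) _ _ (mrestr P mXC) (mscale (NngNum PC0) P) cylinder_off_setI _ _ A sA.
rewrite /= /mrestr /mscale /= -PC; apply.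
- move=> _; exists [::], (fun=> setT); split => //.
  by apply/seteqP; split.
- by apply/seteqP; split => // w _; exists 0%N.
- by move=> B BG; exact: cylinder_off_independent.
- by move=> _; rewrite setTI PC ltry.
Qed.

Lemma site_independent_integralM (Z : T -> R) (f : R -> R) :
  measurable_fun setT f -> (forall r, 0 <= f r)%R -> (forall w, 0 <= Z w)%R ->
  measurable_fun setT (Z : g_sigma_algebraType cylinder_off -> R) ->
  \int[P]_w (f (X i w) * Z w)%:E =
  (\int[P]_w (f (X i w))%:E) * (\int[P]_w (Z w)%:E).
Proof.
move=> mf f0 Z0 mZ.
have sZ B : measurable B -> <<s cylinder_off >> (Z @^-1` B).
  by move=> mB; have := mZ measurableT B mB; rewrite setTI.
have mZT : measurable_fun setT (Z : T -> R).
  move=> _ B mB; rewrite setTI; have := sZ B mB.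
  apply: smallest_sub; first exact: sigma_algebra_measurable.
  exact: cylinder_off_measurable.
have mfX : measurable_fun setT (f \o X i) by exact: measurableT_comp.
pose Zmixin := isMeasurableFun.Build _ _ _ _ _ mZT.
pose Z' : {mfun T >-> R} := HB.pack (Z : T -> R) Zmixin.
pose Ymixin := isMeasurableFun.Build _ _ _ _ _ mfX.
pose Y' : {mfun T >-> R} := HB.pack (f \o X i) Ymixin.
apply: (@independent_integralM Y' Z') => //= A B mA mB.
have mfA : measurable (f @^-1` A) by have := mf measurableT A mA; rewrite setTI.
exact: (sigma_off_independent (sZ B mB) mfA).
Qed.

End independence.

(** * The annealed recursion *)

Section mean.
Context (dT : measure_display) (T : measurableType dT) (R : realType).
Variable P : probability T R.

Lemma integrable_bounded (f : T -> R) (C : R) :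
  measurable_fun setT f -> (forall w, 0 <= f w <= C) ->
  P.-integrable setT (EFin \o f).
Proof.
move=> mf fC; apply: measurable_bounded_integrable => //.
  by rewrite ltey_eq fin_num_measure.
exists C; split; first exact: num_real.
move=> x Cx w _ /=; have /andP[f0 fwC] := fC w.
by rewrite ger0_norm// (le_trans fwC) // ltW.
Qed.

Lemma integral_cst_probability (c : R) : (\int[P]_w c%:E = c%:E)%E.
Proof.
rewrite (integral_cst P measurableT) -[RHS]mule1; congr (_ * _)%E.
exact: probability_setT.
Qed.

Lemma Rintegral_cst_probability (c : R) : \int[P]_w c = c.
Proof. by rewrite /Rintegral integral_cst_probability. Qed.

Lemma Rintegral_avg d (f : 'Zd_d -> T -> R) y :
  (forall x, P.-integrable setT (EFin \o f x)) ->
  \int[P]_w avg (f ^~ w) y = avg (fun x => \int[P]_w f x w) y.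
Proof.
move=> intf; have int2 i : P.-integrable setT
    (EFin \o (fun w => f (y + delta_mx 0 i) w + f (y - delta_mx 0 i) w)).
  exact: (integrableD _ (intf _) (intf _)).
have intS (r : seq 'I_d) : P.-integrable setT (EFin \o (fun w =>
    \sum_(i <- r) (f (y + delta_mx 0 i) w + f (y - delta_mx 0 i) w))).
  rewrite (_ : _ \o _ = (fun w =>
    \sum_(i <- r) (f (y + delta_mx 0 i) w + f (y - delta_mx 0 i) w)%:E)%E).
    by apply: integrable_sum => // i _; exact: int2.
  by apply/funext => w /=; rewrite sumEFin.
rewrite /avg RintegralZl//.
congr (_ * _); elim: (index_enum _) => [|i r IH].
  rewrite big_nil; under eq_Rintegral do rewrite big_nil.
  by rewrite Rintegral_cst_probability.
rewrite big_cons -IH; under eq_Rintegral do rewrite big_cons.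
by rewrite RintegralD// RintegralD.
Qed.

End mean.

Section annealed.
Context (dT : measure_display) (T : measurableType dT) (R : realType).
Variables (P : probability T R) (d : nat) (V : 'Zd_d -> {RV P >-> R}).
Variables (l : 'rV[R]_d) (L theta gamma M : R).
Hypothesis d0 : (0 < d)%N.
Hypothesis iidV : iid V.
Hypothesis V0 : forall x w, 0 <= V x w.
Hypothesis l_unit : \sum_(i < d) l 0 i ^+ 2 = 1.
Hypothesis L1 : 1 < L.
Hypothesis theta0 : 0 < theta.
Hypothesis gamma0 : 0 < gamma.
Hypothesis M0 : 0 <= M.

(** Truncation bounds the effect of a single site, and only lowers the potential;
    the level [M] is sent to infinity at the end, which also covers a potential of
    infinite mean. *)
Definition truncated x w : R := Num.min (V x w) M.

Definition truncated_mean : R := \int[P]_w truncated 0 w.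

(** Relative error made by treating the potential at a site as independent of
    the Green's function at that site. *)
Definition site_error : R := gamma * M * ((2 * d)%:R * (L + 1)).

Local Notation a := ((1 - site_error) * (gamma * truncated_mean)).
Local Notation U := (fun x w => gamma * truncated x w).
Local Notation F n j y := (fun w => levelN l L (U ^~ w) n j y).
Local Notation s := (height l).

Hypothesis error1 : site_error <= 1.
Hypothesis cosh_a : \sum_(i < d) coshR (theta * l 0 i) <= d%:R * (1 + a).

Lemma truncated_ge0 x w : 0 <= truncated x w.
Proof. by rewrite le_min V0. Qed.

Lemma measurable_truncated x : measurable_fun setT (truncated x).
Proof. by apply: measurable_minr => //; exact: measurable_cst. Qed.

Lemma truncated_le x w : truncated x w <= M.
Proof. by rewrite ge_min lexx orbT. Qed.

Lemma integral_truncated x : (\int[P]_w (truncated x w)%:E = truncated_mean%:E)%E.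
Proof.
have mmin : measurable_fun setT (fun r : R => (Num.max (Num.min r M) 0)%:E).
  apply/measurable_EFinP; apply: measurable_maxr => //.
  exact: measurable_minr.
have dist k : (\int[P]_w (truncated k w)%:E =
    \int[distribution P (V k)]_r (Num.max (Num.min r M) 0)%:E)%E.
  rewrite ge0_integral_distribution//; last by move=> r; rewrite lee_fin le_max lexx orbT.
  apply: eq_integral => w _ /=; congr EFin.
  by rewrite max_l// truncated_ge0.
rewrite /truncated_mean /Rintegral fineK.
  rewrite !dist; apply: eq_measure_integral => A mA _.
  by have [_] := iidV; exact.
apply: integrable_fin_num => //; apply: (@integrable_bounded _ _ _ _ _ M).
  exact: measurable_truncated.
by move=> w; rewrite truncated_ge0 truncated_le.
Qed.

Lemma truncated_mean_ge0 : 0 <= truncated_mean.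
Proof. by apply: Rintegral_ge0 => w _; exact: truncated_ge0. Qed.

Let U0 x w : 0 <= U x w.
Proof. by rewrite mulr_ge0 ?truncated_ge0// ltW. Qed.

Let mU x : measurable_fun setT (U x).
Proof. by apply: measurable_funM; [exact: measurable_cst|exact: measurable_truncated]. Qed.

Let intF n j y : P.-integrable setT (EFin \o F n j y).
Proof.
apply: (@integrable_bounded _ _ _ _ _ n%:R); first exact: measurable_levelN.
by move=> w; rewrite levelN_ge0//= levelN_le.
Qed.

Let intVF n j y : P.-integrable setT (EFin \o (fun w => truncated y w * F n j y w)).
Proof.
apply: (@integrable_bounded _ _ _ _ _ (M * n%:R)).
  by apply: measurable_funM; [exact: measurable_truncated|exact: measurable_levelN].
move=> w; rewrite mulr_ge0 ?truncated_ge0 ?levelN_ge0//=.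
by rewrite ler_pM ?truncated_ge0 ?truncated_le ?levelN_ge0 ?levelN_le.
Qed.

(** The value [F] at [y] differs by a relative [site_error] from the value [F0]
    computed with the potential removed at [y], and [F0] is independent of that
    potential. *)
Lemma mean_site_charge n j y : slab l L j y ->
  (1 - site_error) * truncated_mean * \int[P]_w F n j y w <=
  \int[P]_w (truncated y w * F n j y w).
Proof.
move=> yj; pose Uoff x w : R := if x == y then 0 else U x w.
have Uoff0 x w : 0 <= Uoff x w by rewrite /Uoff; case: ifP.
pose F0 w := levelN l L (Uoff ^~ w) n j y.
have F00 w : 0 <= F0 w by exact: levelN_ge0.
have mF0off : measurable_fun setT (F0 : g_sigma_algebraType (cylinder_off V y) -> R).
  apply: measurable_levelN => [|x]; first exact: Uoff0.
  rewrite /Uoff; case: eqP => [_|/eqP xy]; first exact: measurable_cst.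
  apply: measurable_funM; first exact: measurable_cst.
  apply: measurable_minr; last exact: measurable_cst.
  move=> _ B mB; rewrite setTI; apply: sub_sigma_algebra.
  exists [:: x], (fun=> B); split => //; first by rewrite inE eq_sym.
  by apply/seteqP; split => [w Bw k|w /(_ x)]; rewrite /= inE ?eqxx;
    [move=> /eqP ->|exact].
have mF0 : measurable_fun setT F0.
  apply: measurable_levelN => // x; rewrite /Uoff.
  by case: eqP => _; [exact: measurable_cst|exact: mU].
have F0n w : F0 w <= n%:R by exact: levelN_le.
have intF0 : P.-integrable setT (EFin \o F0).
  by apply: (@integrable_bounded _ _ _ _ _ n%:R) => // w; rewrite F00/=.
have F_F0 w : F n j y w <= F0 w.
  apply: levelN_anti => // x; rewrite /Uoff; case: ifP => // _.
have F0_F w : (1 - site_error) * F0 w <= F n j y w.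
  have := @levelN_single_site _ _ l L d0 l_unit (ltW L1) (U ^~ w) (Uoff ^~ w) j y n.
  move=> /(_ (U0 ^~ w)) H.
  have {}H : F0 w - F n j y w <= U y w * ((2 * d)%:R * (L + 1)) * F0 w.
    apply: H => //; first by move=> x /negbTE xy; rewrite /Uoff xy.
    by rewrite /Uoff eqxx.
  have : U y w * ((2 * d)%:R * (L + 1)) * F0 w <= site_error * F0 w.
    rewrite ler_wpM2r// ler_wpM2r//.
      by rewrite mulr_ge0// addr_ge0// ltW// (lt_trans _ L1).
    by rewrite ler_wpM2l ?truncated_le// ltW.
  by rewrite mulrBl mul1r; lra.
have err0 : 0 <= 1 - site_error by rewrite subr_ge0.
have product : \int[P]_w (truncated y w * F0 w) = truncated_mean * \int[P]_w F0 w.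
  have mminM : measurable_fun setT (fun r : R => Num.max (Num.min r M) 0).
    by apply: measurable_maxr => //; exact: measurable_minr.
  have := @site_independent_integralM _ _ _ _ _ V (proj1 iidV) y F0
    (fun r => Num.max (Num.min r M) 0) mminM.
  move=> /(_ _ F00 mF0off) /= H.
  have truncE w : Num.max (Num.min (V y w) M) 0 = truncated y w.
    by rewrite max_l// truncated_ge0.
  have f0 r : 0 <= Num.max (Num.min r M) 0 by rewrite le_max lexx orbT.
  have {H} := H f0; under eq_integral do rewrite truncE.
  have -> : (\int[P]_w (Num.max (Num.min (V y w) M) 0)%:E = truncated_mean%:E)%E.
    by rewrite -(integral_truncated y); apply: eq_integral => w _; rewrite truncE.
  rewrite /Rintegral => ->; rewrite fineM//.
  exact: integrable_fin_num.
have intVF0 : P.-integrable setT (EFin \o (fun w => truncated y w * F0 w)).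
  apply: (@integrable_bounded _ _ _ _ _ (M * n%:R)).
    by apply: measurable_funM => //; exact: measurable_truncated.
  by move=> w; rewrite mulr_ge0 ?truncated_ge0//= ler_pM ?truncated_ge0 ?truncated_le.
apply: (@le_trans _ _ ((1 - site_error) * \int[P]_w (truncated y w * F0 w))).
  rewrite product -mulrA ler_wpM2l// ler_wpM2l ?truncated_mean_ge0//.
  by apply: le_Rintegral.
rewrite -RintegralZl//; apply: le_Rintegral => //.
  exact: (integrableZl _ _ intVF0).
by move=> w _; rewrite mulrCA ler_wpM2l ?truncated_ge0.
Qed.

(** Integrating the recursion and bounding the charge by [mean_site_charge] gives
    the recursion with a constant killing rate inside the slabs, of which
    [level_bound] is a supersolution.  The bound is uniform in the time [n], so no
    moment of the Green's function has to be known beforehand. *)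
Lemma mean_levelN_le n j y : j%:~R * L < s y ->
  \int[P]_w F n j y w <= level_bound l L theta j y.
Proof.
have a0 : 0 <= a by rewrite mulr_ge0 ?subr_ge0// mulr_ge0 ?truncated_mean_ge0// ltW.
elim: n j y => [|n IH] j y jy.
  by rewrite Rintegral_cst_probability; exact: level_bound_ge0.
pose ch : R := if slab l L j y then a else 0.
have ch0 : 0 <= ch by rewrite /ch; case: ifP.
have ch1 : 0 < 1 + ch by rewrite ltr_pwDl.
rewrite -(ler_pM2l ch1); apply: (le_trans _ (level_bound_super d0 l_unit L1 theta0 a0 cosh_a jy)).
pose G x w := F n (level l L j x) x w.
apply: (@le_trans _ _ (avg (fun x => \int[P]_w G x w) y + (y == 0)%:R)); last first.
  rewrite lerD2r; apply: le_avg => x yx; apply: IH.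
  exact: (level_height l_unit (ltW L1) yx jy).
have step w : (1 + if slab l L j y then U y w else 0) * F n.+1 j y w =
    avg (G ^~ w) y + (y == 0)%:R.
  by rewrite /= mulrC divfK// gt_eqF// ltr_pwDl//; case: ifP.
have mG x : measurable_fun setT (G x) by exact: measurable_levelN.
have intG : P.-integrable setT (EFin \o (fun w => avg (G ^~ w) y)).
  apply: (@integrable_bounded _ _ _ _ _ n%:R); first exact: measurable_avg.
  move=> w; rewrite avg_ge0 => [|x _]; last exact: levelN_ge0.
  by rewrite -[leRHS](avg_cst _ y d0); apply: le_avg => x _; exact: levelN_le.
have -> : avg (fun x => \int[P]_w G x w) y + (y == 0)%:R =
    \int[P]_w (avg (G ^~ w) y + (y == 0)%:R).
  rewrite RintegralD//; last exact: finite_measure_integrable_cst.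
  rewrite (@Rintegral_avg _ _ _ P _ G); last by move=> x; exact: intF.
  by rewrite Rintegral_cst_probability.
have -> : \int[P]_w (avg (G ^~ w) y + (y == 0)%:R) =
    \int[P]_w ((1 + if slab l L j y then U y w else 0) * F n.+1 j y w).
  by apply: eq_Rintegral => w _; rewrite step.
rewrite /ch; case: ifPn => yj; last first.
  rewrite addr0 mul1r le_eqVlt; apply/orP; left; apply/eqP.
  by apply: eq_Rintegral => w _; rewrite mul1r.
rewrite [leRHS](_ : _ = \int[P]_w (F n.+1 j y w + gamma * (truncated y w * F n.+1 j y w))).
  rewrite RintegralD//; last exact: (integrableZl _ _ (intVF _ _ _)).
  rewrite RintegralZl// mulrDl mul1r lerD2l.
  have := ler_wpM2l (ltW gamma0) (mean_site_charge n.+1 yj).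
  by apply: le_trans; rewrite le_eqVlt; apply/orP; left; apply/eqP; ring.
by apply: eq_Rintegral => w _; rewrite mulrDl mul1r mulrA.
Qed.

Lemma mean_greenN_le n (J : nat) y : J%:R * L < s y ->
  \int[P]_w greenN (fun x => gamma * V x w) n y <=
  source_size d L theta * slab_gain L theta / slab_gain L theta ^+ J.
Proof.
move=> Jy; apply: (@le_trans _ _ (\int[P]_w F n (Posz J) y w)).
  apply: le_Rintegral => // [|w _].
    apply: (@integrable_bounded _ _ _ _ _ n%:R).
      apply: measurable_greenN => x; first by move=> w; rewrite mulr_ge0// ltW.
      by apply: measurable_funM => //; exact: measurable_cst.
    move=> w; have gV0 x : 0 <= gamma * V x w by rewrite mulr_ge0// ltW.
    by rewrite greenN_ge0//= greenN_le_steps.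
  apply: greenN_le_levelN => // x.
  by apply: ler_wpM2l; [exact: ltW|rewrite /truncated ge_min lexx].
apply: le_trans (mean_levelN_le _ _) _; first by rewrite /= -pmulrn.
rewrite /level_bound addr0 /amplitude mulrAC ler_wpM2r//.
  by rewrite invr_ge0 exprn_ge0// ltW// (lt_trans _ (slab_gain_gt1 _ _)).
rewrite ler_wpM2l ?profile_le ?ltW ?source_size_gt0//.
by rewrite subr_gt0 /= -pmulrn.
Qed.

End annealed.

(** * Lower bound for a constant potential *)

Section norm1.
Context (d : nat).
Implicit Types (x y : 'Zd_d).

Definition norm1 y : nat := (\sum_(i < d) absz (y 0%R i))%N.

Lemma norm1_step y : y != 0 -> exists2 x, neighbour y x & (norm1 x < norm1 y)%N.
Proof.
move=> y0; have [i yi] : exists i, y 0 i != 0.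
  apply/existsP; apply: contraNT y0; rewrite negb_exists => /forallP y0.
  apply/eqP/rowP => i; rewrite mxE; apply/eqP; exact/negPn.
have drop (e : int) : (absz (y 0%R i + e)%R < absz (y 0%R i))%N ->
    (norm1 (y + e *: delta_mx 0 i)%R < norm1 y)%N.
  move=> lt; rewrite /norm1 (bigD1 i)//= [X in (_ < X)%N](bigD1 i)//=.
  rewrite !mxE !eqxx mulr1 -addSn leq_add// leq_eqVlt; apply/orP; left; apply/eqP.
  by apply: eq_bigr => j /negbTE ji; rewrite !mxE ji andbF mulr0 addr0.
have [yi0|yi0|/eqP] := ltgtP (y 0 i) 0; last by rewrite (negbTE yi).
  exists (y + 1 *: delta_mx 0 i); last by apply: drop; lia.
  by exists i; left; rewrite scale1r.
exists (y + (- 1) *: delta_mx 0 i); last by apply: drop; lia.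
by exists i; right; rewrite scaleN1r.
Qed.

End norm1.

Section constant_potential.
Context (R : realType) (d : nat) (c theta : R).
Hypothesis d0 : (0 < d)%N.
Hypothesis c0 : 0 < c.
Hypothesis theta0 : 0 < theta.
Hypothesis c_theta : (2 * d)%:R * c < theta ^+ 2.
Implicit Types (x y : 'Zd_d).

Definition normsq y : R := \sum_(i < d) (y 0 i)%:~R ^+ 2.

(** The added [1] makes the radius smooth at the origin. *)
Definition radius y : R := Num.sqrt (normsq y + 1).

Definition radial y : R := expR (- theta * radius y).

Lemma normsq_ge0 y : 0 <= normsq y.
Proof. by apply: sumr_ge0 => i _; exact: sqr_ge0. Qed.

Lemma radius_ge1 y : 1 <= radius y.
Proof. by rewrite -[leLHS]sqrtr1 ler_wsqrtr// lerDr normsq_ge0. Qed.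

Let radius0 y : 0 < radius y.
Proof. exact: lt_le_trans (radius_ge1 y). Qed.

Lemma sqr_radius y : radius y ^+ 2 = normsq y + 1.
Proof. by rewrite sqr_sqrtr// addr_ge0// normsq_ge0. Qed.

Lemma radial_le1 y : radial y <= 1.
Proof. by rewrite -expR0 ler_expR mulNr oppr_le0 mulr_ge0// ltW. Qed.

Lemma normsq_shift y i (e : int) : e * e = 1 ->
  normsq (y + e *: delta_mx 0 i) = normsq y + (e%:~R * (y 0 i)%:~R) *+ 2 + 1.
Proof.
move=> ee; rewrite /normsq (bigD1 i)//= [in RHS](bigD1 i)//=.
rewrite !mxE !eqxx mulr1 rmorphD.
rewrite (eq_bigr (fun k => (y 0 k)%:~R ^+ 2)) => [|k /negbTE ki]; last first.
  by rewrite !mxE eqxx ki mulr0 addr0.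
have : e%:~R * e%:~R = 1 :> R by rewrite -rmorphM ee.
by move=> ee1; rewrite sqrrD; lra.
Qed.

(** The tangent line of the square root bounds the radius of a neighbour. *)
Lemma radius_shift y i (e : int) : e * e = 1 ->
  radius (y + e *: delta_mx 0 i) <=
  radius y + ((e%:~R * (y 0 i)%:~R) *+ 2 + 1) / (2 * radius y).
Proof.
move=> ee; set b := _ + 1.
have rb : 0 <= radius y ^+ 2 + b.
  have := normsq_ge0 (y + e *: delta_mx 0 i).
  by rewrite normsq_shift// sqr_radius /b; lra.
have rhs0 : 0 <= radius y + b / (2 * radius y).
  have -> : radius y + b / (2 * radius y) =
      (radius y ^+ 2 + (radius y ^+ 2 + b)) / (2 * radius y).
    by field; rewrite gt_eqF.
  apply: divr_ge0; first exact: addr_ge0 (sqr_ge0 _) rb.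
  by apply: mulr_ge0 => //; exact: ltW.
rewrite -(ler_pXn2r (_ : 0 < 2)%N) ?nnegrE ?sqrtr_ge0// sqr_radius normsq_shift//.
have -> : normsq y + (e%:~R * (y 0 i)%:~R) *+ 2 + 1 + 1 = radius y ^+ 2 + b.
  by rewrite sqr_radius /b; ring.
rewrite -subr_ge0 (_ : _ - _ = (b / (2 * radius y)) ^+ 2) ?sqr_ge0//.
by field; rewrite gt_eqF.
Qed.

Lemma radial_pair y i :
  2 * radial y * (1 - theta / (2 * radius y)) *
    (1 + (theta * (y 0 i)%:~R / radius y) ^+ 2 / 2) <=
  radial (y + delta_mx 0 i) + radial (y - delta_mx 0 i).
Proof.
set r := radius y; set t := theta * _ / r.
have shift (e : int) : e * e = 1 ->
    radial y * expR (- (theta / (2 * r))) * expR (- e%:~R * t) <=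
    radial (y + e *: delta_mx 0 i).
  move=> ee; rewrite -!expRD ler_expR !mulNr -opprD -opprD lerN2.
  have := ler_wpM2l (ltW theta0) (radius_shift y i ee).
  move=> /le_trans; apply; rewrite le_eqVlt; apply/orP; left; apply/eqP.
  by rewrite /t -/r; field; exact: lt0r_neq0 (radius0 y).
have s1 := shift 1 erefl; have sN1 := shift (- 1) erefl.
rewrite scale1r in s1; rewrite scaleN1r in sN1.
apply: le_trans (lerD s1 sN1).
rewrite rmorphN rmorph1 opprK mulNr mul1r -mulrDr.
have -> : expR (- t) + expR t = 2 * coshR t by rewrite /coshR; field.
rewrite [leRHS](_ : _ = 2 * radial y * (expR (- (theta / (2 * r))) * coshR t)); last by ring.
rewrite -mulrA ler_wpM2l//; first by rewrite mulr_ge0// expR_ge0.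
apply: (@le_trans _ _ (expR (- (theta / (2 * r))) * (1 + t ^+ 2 / 2))).
  by rewrite ler_wpM2r ?expR_ge1Dx// addr_ge0// divr_ge0// sqr_ge0.
by rewrite ler_wpM2l ?expR_ge0// coshR_ge.
Qed.

(** Far from the origin the curvature of the spheres is negligible, and the
    exponential is a subsolution because its rate exceeds that of the Green's
    function. *)
Lemma radial_subharmonic : exists R0, forall y, R0 <= radius y ->
  (1 + c) * radial y <= avg radial y.
Proof.
have d2 : 0 < (2 * d)%:R :> R by rewrite ltr0n muln_gt0.
pose q := theta ^+ 2 / (2 * d)%:R.
have qc : c < q by rewrite ltr_pdivlMr// mulrC.
pose D := q + theta * (1 + q) / 2.
have q0 : 0 < q by exact: lt_trans qc.
have D0 : 0 < D by rewrite addr_gt0// divr_gt0// mulr_gt0// addr_gt0.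
exists (D / (q - c)) => y Ry; set r := radius y in Ry *.
have r0 : 0 < r := radius0 y.
have qc0 : 0 < q - c by rewrite subr_gt0.
pose eta := r^-1.
have eta0 : 0 < eta by rewrite invr_gt0.
have eta1 : eta <= 1 by rewrite invf_le1// radius_ge1.
have etaD : eta * D <= q - c.
  by rewrite mulrC ler_pdivrMr// -ler_pdivrMl// mulrC.
apply: (@le_trans _ _ (radial y * ((1 - theta * eta / 2) * (1 + q - q * eta ^+ 2)))).
  rewrite mulrC ler_wpM2l ?expR_ge0//.
  have : q * eta ^+ 2 <= q * eta.
    by rewrite ler_wpM2l ?(ltW q0)// expr2 ler_piMl// ltW.
  have : 0 <= (theta * eta / 2) * (q * eta ^+ 2).
    by rewrite mulr_ge0// ?divr_ge0 ?mulr_ge0 ?sqr_ge0// ltW.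
  by move: etaD; rewrite /D; lra.
rewrite /avg ler_pdivlMl//.
apply: le_trans (ler_sum _ (fun i _ => radial_pair y i)).
rewrite -mulr_sumr big_split/= sumr_const card_ord.
have -> : \sum_(i < d) (theta * (y 0 i)%:~R / radius y) ^+ 2 / 2 =
    theta ^+ 2 * (r ^+ 2 - 1) / r ^+ 2 / 2.
  rewrite sqr_radius addrK -mulr_suml; congr (_ / _).
  rewrite /normsq mulr_sumr mulr_suml; apply: eq_bigr => i _.
  by rewrite -sqr_radius; field; exact: lt0r_neq0 (radius0 y).
rewrite le_eqVlt; apply/orP; left; apply/eqP.
rewrite -/r /q /eta natrM; field.
by rewrite (gt_eqF r0) pnatr_eq0 -lt0n d0.
Qed.

Lemma greenN_cst_ge k y : (norm1 y <= k)%N ->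
  ((2 * d)%:R * (1 + c)) ^- k.+1 <= greenN (fun=> c) k.+1 y.
Proof.
have d2 : 1 <= (2 * d)%:R :> R by rewrite ler1n muln_gt0.
have c1 : 0 < 1 + c by rewrite addr_gt0.
have D1 : 1 <= (2 * d)%:R * (1 + c) by rewrite mulr_ege1// lerDl ltW.
have D0 : 0 < (2 * d)%:R * (1 + c) by exact: lt_le_trans D1.
have g0 n (x : 'Zd_d) : 0 <= greenN (fun=> c) n x by apply: greenN_ge0 => // _; exact: ltW.
have at0 n : ((2 * d)%:R * (1 + c)) ^- n.+1 <= greenN (fun=> c) n.+1 (0 : 'Zd_d).
  apply: (@le_trans _ _ (1 + c)^-1).
    rewrite lef_pV2 ?posrE ?exprn_gt0// exprS -[leLHS]mulr1 ler_pM//.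
    - exact: ltW.
    - by rewrite ler_peMl// ltW.
    - by rewrite exprn_ege1.
  rewrite /= eqxx -[leLHS]mul1r ler_pM2r ?invr_gt0// -[leLHS]add0r.
  by apply: lerD => //; apply: avg_ge0 => x _; exact: g0.
elim: k y => [|k IH] y yk; have [->|/norm1_step[x yx xy]] := eqVneq y 0; rewrite ?at0//.
  by have := leq_trans xy yk; rewrite ltn0.
have xk : (norm1 x <= k)%N by rewrite -ltnS (leq_trans xy).
rewrite exprS invfM; apply: (@le_trans _ _
    ((2 * d)%:R^-1 * greenN (fun=> c) k.+1 x / (1 + c))).
  rewrite invfM mulrAC ler_pM2r ?invr_gt0// ler_pM2l ?invr_gt0 ?IH//.
  exact: lt_le_trans d2.
rewrite [leRHS]/= ler_pM2r ?invr_gt0// -[leLHS]addr0; apply: lerD => //.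
exact: avg_ge_neighbour.
Qed.

Lemma norm1_le_radius y (N : nat) : radius y <= N%:R -> (norm1 y <= d * N)%N.
Proof.
move=> yN; rewrite -[X in (_ <= X * _)%N]card_ord -sum_nat_const; apply: leq_sum => i _.
rewrite -(@ler_nat R) (le_trans _ yN)// natr_absz intr_norm.
rewrite -(ler_pXn2r (_ : 0 < 2)%N) ?nnegrE// ?real_normK ?num_real//; last exact: ltW.
rewrite sqr_radius /normsq (bigD1 i)//= -addrA lerDl addr_ge0//.
by apply: sumr_ge0 => k _; exact: sqr_ge0.
Qed.

(** The time cut-off costs at most [(1 + c) ^- n], by the maximum principle: the
    constant killing rate contracts the excess of [radial]. *)
Lemma radial_le_greenN_remainder : exists K n0, 0 < K /\
  forall n y, radial y <= K * greenN (fun=> c) (n0 + n) y + (1 + c) ^- n.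
Proof.
have c1 : 0 < 1 + c by rewrite addr_gt0.
have [R0 sub] := radial_subharmonic.
pose N := (Num.truncn R0).+1; pose m := (d * N)%N.
pose K := ((2 * d)%:R * (1 + c)) ^+ m.+1.
have K0 : 0 < K by rewrite exprn_gt0// mulr_gt0// ltr0n muln_gt0.
exists K, m.+1; split => //; elim=> [|n IH] y.
  rewrite expr0 invr1 (le_trans (radial_le1 y))// lerDr mulr_ge0//; first exact: ltW.
  by apply: greenN_ge0 => // _; exact: ltW.
have [Ry|yR] := leP R0 (radius y).
  rewrite -(ler_pM2l c1); apply: le_trans (sub y Ry) _.
  apply: (@le_trans _ _ (avg (fun x => K * greenN (fun=> c) (m.+1 + n) x + (1 + c) ^- n) y)).
    by apply: le_avg => x _.
  have gS : (1 + c) * greenN (fun=> c) (m.+1 + n.+1) y =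
      avg (greenN (fun=> c) (m.+1 + n)) y + (y == 0)%:R.
    by rewrite addnS /= mulrC divfK// gt_eqF.
  have rS : (1 + c) * (1 + c) ^- n.+1 = (1 + c) ^- n.
    by rewrite exprS invfM mulrA divff ?mul1r// gt_eqF.
  rewrite avgD avgZ avg_cst// mulrDr rS [X in _ <= X + _]mulrCA gS lerD2r ler_pM2l// lerDl.
  exact: ler0n.
apply: le_trans (radial_le1 y) _; apply: (@le_trans _ _ (K * greenN (fun=> c) m.+1 y)).
  rewrite -ler_pdivrMl// mulr1; apply: greenN_cst_ge; apply: norm1_le_radius.
  by apply: ltW; apply: lt_trans yR _; exact: real_truncnS_gt (num_real _).
rewrite -[leLHS]addr0; apply: lerD; last by rewrite invr_ge0 exprn_ge0// ltW.
rewrite ler_wpM2l ?(ltW K0)//; apply: greenN_nondecreasing => //.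
  by move=> _; exact: ltW.
exact: leq_addr.
Qed.

Lemma radial_le_greenN : exists2 K, 0 < K &
  forall y, exists n, radial y <= K * greenN (fun=> c) n y.
Proof.
have c1 : 0 < 1 + c by rewrite addr_gt0.
have [K [n0 [K0 H]]] := radial_le_greenN_remainder.
exists (2 * K); first by rewrite mulr_gt0.
move=> y; have ry : 0 < radial y by exact: expR_gt0.
have z1 : `|(1 + c)^-1| < 1.
  by rewrite normfV gtr0_norm// invf_lt1// ltrDl.
have ry2 : 0 < radial y / 2 by rewrite divr_gt0.
have /cvgrPdist_lt /(_ _ ry2) [n _ /(_ n (leqnn n)) /=] := cvg_expr z1.
rewrite sub0r normrN normrX normfV (gtr0_norm c1) exprVn => small.
exists (n0 + n)%N; have := H n y; lra.
Qed.

End constant_potential.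

(** * Bounds on the two means of the Green's function *)

Lemma greenN_gt0 (R : realType) d (U : 'Zd_d -> R) k y :
  (0 < d)%N -> (forall x, 0 <= U x) -> (norm1 y <= k)%N -> 0 < greenN U k.+1 y.
Proof.
move=> d0 U0; have U1 x : 0 < 1 + U x by rewrite ltr_pwDl.
have at0 n : 0 < greenN U n.+1 0.
  rewrite /= eqxx divr_gt0// ltr_wpDl// avg_ge0// => x _; exact: greenN_ge0.
elim: k y => [|k IH] y yk; have [->|/norm1_step[x yx xy]] := eqVneq y 0; rewrite ?at0//.
  by have := leq_trans xy yk; rewrite ltn0.
have xk : (norm1 x <= k)%N by rewrite -ltnS (leq_trans xy).
rewrite divr_gt0// ltr_wpDr// (lt_le_trans _ (avg_ge_neighbour _ yx))//.
  by rewrite mulr_gt0 ?IH// invr_gt0 ltr0n muln_gt0.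
exact: (greenN_ge0 U0 k.+1).
Qed.

Section two_means.
Context (dT : measure_display) (T : measurableType dT) (R : realType).
Variables (P : probability T R) (d : nat) (U : 'Zd_d -> T -> R).
Hypothesis d0 : (0 < d)%N.
Hypothesis U0 : forall x w, 0 <= U x w.
Hypothesis mU : forall x, measurable_fun setT (U x).

(** Were the bounded solution not unique, [green] would vanish and so would
    [ln green], whereas the exponent of a nonzero vector is positive. *)
Lemma green_unique_ae N : is_quenched_exponent P U N ->
  {ae P, forall w, unique (bounded_green_solution (U ^~ w)) (green (U ^~ w))}.
Proof.
move=> [[_ _ N0] Nae _]; apply: filterS Nae => w.
pose z : 'Zd_d := delta_mx 0 (Ordinal d0).
move=> /(_ z); rewrite /green; case: xgetP => [g -> //|noU] /=.
rewrite ln0// oppr0 => Nz; exfalso.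
have : N (Zd_to_Rd R z) = 0.
  apply: (@cvg_unique _ _ _ _ _ _ Nz) => //.
  rewrite (_ : (fun _ => _) = fun=> 0); first exact: cvg_cst.
  by apply/funext => k; rewrite mul0r.
move/N0 => /rowP/(_ (Ordinal d0)); rewrite !mxE !eqxx.
by move/eqP; rewrite intr_eq0.
Qed.

Hypothesis uniqU :
  {ae P, forall w, unique (bounded_green_solution (U ^~ w)) (green (U ^~ w))}.

Section lower.
Variables (b p : R) (y : 'Zd_d) (n : nat).
Hypothesis b0 : 0 <= b.
Hypothesis cU : forall x, centered P (fun w => b - U x w).
Hypothesis p0 : 0 < p.
Hypothesis p_greenN : p <= greenN (fun=> expR b - 1) n y.

Let integral_affine (r k : R) Q : centered P Q ->
  measurable_fun setT (fun w => (r + k * Q w)%:E) /\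
  (\int[P]_w (r + k * Q w)%:E = r%:E)%E.
Proof.
move=> cQ; have [ikQ kQ0] := centeredZ k cQ; split.
  apply/measurable_EFinP; apply: measurable_funD; first exact: measurable_cst.
  by apply/measurable_EFinP; case/integrableP: ikQ.
under eq_integral do rewrite EFinD.
rewrite integralD//; last exact: finite_measure_integrable_cst.
by rewrite kQ0 adde0 integral_cst_probability.
Qed.

Lemma mean_green_ge : (p%:E <= 'E_P[fun w => green (U ^~ w) y])%E.
Proof.
have [Q cQ QH] := greenN_jensen d0 b0 U0 cU n y.
have [mX EX] := integral_affine p p cQ.
rewrite unlock -EX; apply: ae_le_integral_min => //.
apply: filterS uniqU => w uw; rewrite lee_fin.
apply: le_trans (greenN_le d0 (U0 ^~ w) n y uw); apply: le_trans (QH w).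
apply: (@le_trans _ _ (p * expR (Q w))).
  by rewrite -{1}[p]mulr1 -mulrDr ler_wpM2l ?expR_ge1Dx// ltW.
by rewrite ler_wpM2r ?expR_ge0.
Qed.

Lemma mean_ln_green_ge : ((ln p)%:E <= 'E_P[fun w => ln (green (U ^~ w) y)])%E.
Proof.
have [Q cQ QH] := greenN_jensen d0 b0 U0 cU n y.
have [mX EX] := integral_affine (ln p) 1 cQ.
rewrite unlock -EX; apply: ae_le_integral_min => //.
apply: filterS uniqU => w uw; rewrite lee_fin mul1r.
have pQ : p * expR (Q w) <= green (U ^~ w) y.
  apply: le_trans (greenN_le d0 (U0 ^~ w) n y uw); apply: le_trans (QH w).
  by rewrite ler_wpM2r ?expR_ge0.
have pQ0 : 0 < p * expR (Q w) by rewrite mulr_gt0 ?expR_gt0.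
rewrite -{1}[Q w]expRK -lnM ?posrE ?expR_gt0// ler_ln ?posrE//.
exact: lt_le_trans pQ.
Qed.

End lower.

Section upper.
Variables (W : R) (y : 'Zd_d).
Hypothesis W0 : 0 < W.
Hypothesis mean_greenN : forall n, \int[P]_w greenN (U ^~ w) n y <= W.

Let G w := limn (fun n => (greenN (U ^~ w) n y)%:E).

Let G_nd w : nondecreasing_seq (fun n => (greenN (U ^~ w) n y)%:E).
Proof.
move=> m n mn; rewrite lee_fin.
exact: (greenN_nondecreasing (U0 ^~ w)).
Qed.

Let cvgG w : (greenN (U ^~ w) n y)%:E @[n --> \oo] --> G w.
Proof. exact: ereal_nondecreasing_is_cvgn. Qed.

Let mG : measurable_fun setT G.
Proof.
apply: (@emeasurable_fun_cvg _ _ _ _ (fun n w => (greenN (U ^~ w) n y)%:E)).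
  by move=> n; apply/measurable_EFinP; exact: measurable_greenN.
by move=> w _; exact: cvgG.
Qed.

Let G0 w : (0 <= G w)%E.
Proof.
apply: lime_ge; first exact: cvgG.
by near=> n; rewrite lee_fin greenN_ge0.
Unshelve. all: by end_near. Qed.

Let intG : (\int[P]_w G w <= W%:E)%E.
Proof.
rewrite monotone_convergence//; last 2 first.
- by move=> n; apply/measurable_EFinP; exact: measurable_greenN.
- by move=> n w _; rewrite lee_fin greenN_ge0.
have int_greenN n : P.-integrable setT (EFin \o (fun w => greenN (U ^~ w) n y)).
  apply: (@integrable_bounded _ _ _ _ _ n%:R); first exact: measurable_greenN.
  by move=> w; rewrite greenN_ge0//= greenN_le_steps.
apply: lime_le.
  apply: ereal_nondecreasing_is_cvgn => m n mn; apply: ge0_le_integral => //.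
  - by move=> w _; rewrite lee_fin greenN_ge0.
  - by apply/measurable_EFinP; exact: measurable_greenN.
  - by apply/measurable_EFinP; exact: measurable_greenN.
  - by move=> w _; exact: G_nd.
near=> n; have := mean_greenN n; rewrite -lee_fin /Rintegral fineK//.
exact: (integrable_fin_num measurableT (int_greenN n)).
Unshelve. all: by end_near. Qed.

Let greenG : {ae P, forall w, (green (U ^~ w) y)%:E = G w}.
Proof.
apply: filterS uniqU => w uw; apply/esym/cvg_lim => //.
by apply: cvg_EFin; [near=> n|exact: cvg_greenN].
Unshelve. all: by end_near. Qed.

Lemma mean_green_le : ('E_P[fun w => green (U ^~ w) y] <= W%:E)%E.
Proof.
rewrite unlock; apply: le_trans intG; apply: ae_integral_le => //.
by apply: filterS greenG => w ->.
Qed.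

Lemma mean_ln_green_le : ('E_P[fun w => ln (green (U ^~ w) y)] <= (ln W)%:E)%E.
Proof.
have iG : P.-integrable setT G.
  apply/integrableP; split => //.
  rewrite (eq_integral G) => [|w _]; last by rewrite gee0_abs.
  exact: le_lt_trans intG (ltry _).
pose H w := ((ln W - 1)%:E + W^-1%:E * G w)%E.
have mH : measurable_fun setT H.
  by apply: emeasurable_funD; [exact: measurable_cst|exact: measurable_funeM].
have HW : (\int[P]_w H w <= (ln W)%:E)%E.
  rewrite integralD//; last 2 first.
  - exact: finite_measure_integrable_cst.
  - exact: integrableZl.
  rewrite integralZl// integral_cst_probability.
  rewrite [leRHS](_ : _ = (ln W - 1)%:E + W^-1%:E * W%:E)%E; last first.
    by rewrite -EFinM mulVf ?gt_eqF// -EFinD subrK.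
  by rewrite leeD2l// lee_wpmul2l// lee_fin invr_ge0 ltW.
rewrite unlock; apply: le_trans HW; apply: ae_integral_le => //.
apply: filterS2 greenG uniqU => w gG uw.
have g0 : 0 < green (U ^~ w) y.
  apply: lt_le_trans (greenN_le d0 (U0 ^~ w) (norm1 y).+1 y uw).
  exact: greenN_gt0.
rewrite /H -gG -EFinM -EFinD lee_fin.
have gW : -1 < W^-1 * green (U ^~ w) y - 1.
  by rewrite ltrBrDl subrr mulr_gt0 ?invr_gt0.
have := le_ln1Dx gW.
by rewrite subrKC lnM ?posrE ?invr_gt0// lnV ?posrE//; lra.
Qed.

End upper.

End two_means.

(** * From lattice directions to real vectors *)

Section rates.
Context (R : realType).

Lemma ler_of_linear (a b E : R) : (forall n : nat, n%:R * a <= n%:R * b + E) -> a <= b.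
Proof.
move=> H; rewrite leNgt; apply/negP => ba.
have ab0 : 0 < a - b by rewrite subr_gt0.
pose n := (Num.truncn (E / (a - b))).+1.
have : E / (a - b) < n%:R by exact: real_truncnS_gt (num_real _).
rewrite ltr_pdivrMr//; have := H n; lra.
Qed.

Lemma cvg_rate_le (u : nat -> \bar R) (N B C : R) :
  (forall k, (0 < k)%N -> (u k <= (B + C / k%:R)%:E)%E) ->
  u @ \oo --> N%:E -> N <= B.
Proof.
move=> uB uN; apply/ler_addgt0Pr => e e0; rewrite -lee_fin -(cvg_lim _ uN)//.
apply: lime_le; first by apply/cvg_ex; exists N%:E.
near=> k; have k0 : (0 < k)%N by near: k; exact: nbhs_infty_gt.
apply: (le_trans (uB k k0)); rewrite lee_fin lerD2l ler_pdivrMr ?ltr0n//.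
rewrite mulrC -ler_pdivrMr//; near: k; exact: nbhs_infty_ger.
Unshelve. all: by end_near. Qed.

Lemma cvg_rate_ge (u : nat -> \bar R) (N B C : R) :
  (forall k, (0 < k)%N -> ((B - C / k%:R)%:E <= u k)%E) ->
  u @ \oo --> N%:E -> B <= N.
Proof.
move=> uB uN; rewrite -lerN2; apply: (@cvg_rate_le (fun k => - u k)%E _ _ C).
  by move=> k k0; rewrite leeNl -EFinN opprD opprK; exact: uB.
by rewrite EFinN; exact: cvgeN.
Qed.

End rates.

Section lattice_to_reals.
Context (R : realType) (d : nat) (N : 'rV[R]_d -> R) (l : 'rV[R]_d).
Hypothesis normN : is_norm N.
Hypothesis l_unit : \sum_(i < d) l 0 i ^+ 2 = 1.

Lemma norm_origin : N 0 = 0.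
Proof. by have [_ NZ _] := normN; rewrite -(scale0r 0) NZ normr0 mul0r. Qed.

Lemma norm_opp x : N (- x) = N x.
Proof. by have [_ NZ _] := normN; rewrite -scaleN1r NZ normrN1 mul1r. Qed.

Lemma norm_nonneg x : 0 <= N x.
Proof.
have [ND _ _] := normN; have := ND x (- x).
by rewrite subrr norm_origin norm_opp -mulr2n pmulrn_lge0.
Qed.

Definition norm_bound : R := \sum_(i < d) N (delta_mx 0 i).

Lemma norm_le_bound (e : 'rV[R]_d) : (forall i, `|e 0 i| <= 1) -> N e <= norm_bound.
Proof.
have [ND NZ _] := normN; move=> e1; rewrite [e]row_sum_delta /norm_bound.
elim/big_ind2: _ => [|x1 x2 y1 y2 h1 h2|i _]; first by rewrite norm_origin.
  by apply: le_trans (ND _ _) _; exact: lerD.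
by rewrite NZ ler_piMl// norm_nonneg.
Qed.

(** A norm sees the integer points: [n *: l] is within a bounded distance of
    [lattice_approx n], and the error disappears after division by [n]. *)
Definition lattice_approx (n : nat) : 'Zd_d := \row_i Num.floor (n%:R * l 0 i).

Let remainder n : 'rV[R]_d := n%:R *: l - Zd_to_Rd R (lattice_approx n).

Let remainder_le1 n i : 0 <= remainder n 0 i <= 1.
Proof.
rewrite !mxE; have := real_floor_itv (num_real (n%:R * l 0 i)).
by rewrite rmorphD rmorph1 => /andP[? ?]; lra.
Qed.

Let remainder_norm n : N (remainder n) <= norm_bound.
Proof.
apply: norm_le_bound => i; have /andP[r0 r1] := remainder_le1 n i.
by rewrite ger0_norm.
Qed.

Let coordE n i : (lattice_approx n 0 i)%:~R = n%:R * l 0 i - remainder n 0 i :> R.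
Proof. by rewrite !mxE; ring. Qed.

Lemma normsq_lattice_approx n : normsq R (lattice_approx n) <= (n%:R + d%:R) ^+ 2.
Proof.
apply: (@le_trans _ _ (\sum_(i < d) (n%:R ^+ 2 * l 0 i ^+ 2 + (n%:R *+ 2 + 1)))).
  apply: ler_sum => i _; rewrite coordE.
  have /andP[r0 r1] := remainder_le1 n i; set r := remainder n 0 i in r0 r1 *.
  have := unit_coord_le1 l_unit i; rewrite ler_norml => /andP[l1 l2].
  have n0 : 0 <= n%:R :> R by [].
  have r2 : r ^+ 2 <= 1 by rewrite expr_le1.
  have : - (n%:R * l 0 i * r) <= n%:R.
    rewrite -mulrN -mulrA -[leRHS]mulr1 ler_wpM2l//.
    have rn : `|r| <= 1 by rewrite ger0_norm.
    have : `|l 0 i * r| <= 1 by rewrite normrM mulr_ile1 ?(unit_coord_le1 l_unit).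
    by rewrite ler_norml mulrN => /andP[]; lra.
  by move: r2; rewrite -mulr_natr; nra.
rewrite big_split/= -mulr_sumr l_unit mulr1 sumr_const card_ord.
rewrite -mulr_natr; have : d%:R <= d%:R ^+ 2 :> R.
  by rewrite -natrX ler_nat; case: (d) => // m; rewrite leq_pmulr.
by have n0 : 0 <= n%:R :> R by []; nra.
Qed.

Lemma norm_le_of_lattice C : 0 <= C ->
  (forall z, N (Zd_to_Rd R z) <= C * Num.sqrt (normsq R z)) -> N l <= C.
Proof.
move=> C0 H; have [ND NZ _] := normN.
apply: (@ler_of_linear _ _ _ (C * d%:R + norm_bound)) => n.
have -> : n%:R * N l = N (Zd_to_Rd R (lattice_approx n) + remainder n).
  by rewrite subrKC NZ ger0_norm.
apply: (le_trans (ND _ _)); rewrite addrA; apply: lerD => //.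
apply: (le_trans (H _)); rewrite [n%:R * C]mulrC -mulrDr ler_wpM2l//.
rewrite -[leRHS]ger0_norm ?addr_ge0// -sqrtr_sqr ler_wsqrtr//.
exact: normsq_lattice_approx.
Qed.

Lemma norm_ge_of_lattice r : 0 <= r ->
  (forall z, r * height l z <= N (Zd_to_Rd R z)) -> r <= N l.
Proof.
move=> r0 H; have [ND NZ _] := normN.
apply: (@ler_of_linear _ _ _ (r * d%:R + norm_bound)) => n.
have h : n%:R - d%:R <= height l (lattice_approx n).
  rewrite /height (eq_bigr (fun i => n%:R * l 0 i ^+ 2 - remainder n 0 i * l 0 i)).
    rewrite sumrB -mulr_sumr l_unit mulr1 lerD2l lerN2.
    rewrite -[X in _ <= X%:R]card_ord -sumr_const; apply: ler_sum => i _.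
    have /andP[r1 r2] := remainder_le1 n i.
    have rn : `|remainder n 0 i| <= 1 by rewrite ger0_norm.
    by apply: le_trans (ler_norm _) _; rewrite normrM mulr_ile1 ?(unit_coord_le1 l_unit).
  by move=> i _; rewrite coordE expr2; ring.
have : N (Zd_to_Rd R (lattice_approx n)) <= n%:R * N l + norm_bound.
  have -> : Zd_to_Rd R (lattice_approx n) = n%:R *: l - remainder n.
    by rewrite opprB addrC subrK.
  apply: (le_trans (ND _ _)); rewrite norm_opp NZ ger0_norm// lerD2l//.
have := ler_wpM2l r0 h; have := H (lattice_approx n); rewrite mulrBr; lra.
Qed.

End lattice_to_reals.

(** * Exponents for a fixed coupling constant *)

(** The common form of the two exponents: [G y] stands for the mean of the
    logarithm, or for the logarithm of the mean, of the Green's function. *)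
Definition decay_rate (R : realType) d (G : 'Zd_d -> \bar R) (N : 'rV[R]_d -> R) : Prop :=
  is_norm N /\
  forall z : 'Zd_d, (fun k : nat => - G (z *+ k)%R * (k%:R^-1)%:E)%E @ \oo --> (N (Zd_to_Rd R z))%:E.

Section decay_rate.
Context (R : realType) (d : nat) (G : 'Zd_d -> \bar R) (N : 'rV[R]_d -> R) (l : 'rV[R]_d).
Hypothesis rateN : decay_rate G N.
Hypothesis l_unit : \sum_(i < d) l 0 i ^+ 2 = 1.

Lemma radius_multiple (z : 'Zd_d) k :
  radius R (z *+ k) <= k%:R * Num.sqrt (normsq R z) + 1.
Proof.
have n0 : 0 <= normsq R z := normsq_ge0 R z.
have s0 : 0 <= k%:R * Num.sqrt (normsq R z) by rewrite mulr_ge0// sqrtr_ge0.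
rewrite -(ler_pXn2r (_ : 0 < 2)%N) ?nnegrE ?sqrtr_ge0 ?addr_ge0//.
have -> : radius R (z *+ k) ^+ 2 = k%:R ^+ 2 * normsq R z + 1.
  rewrite sqr_radius; congr (_ + 1); rewrite /normsq mulr_sumr.
  by apply: eq_bigr => i _; rewrite mulmxnE rmorphMn/= -mulr_natl exprMn.
by rewrite sqrrD exprMn sqr_sqrtr// expr1n mulr1 lerD2r lerDl mulrn_wge0.
Qed.

Lemma decay_rate_le theta K : 0 < theta -> 0 < K ->
  (forall y, ((ln (radial theta y / K))%:E <= G y)%E) -> N l <= theta.
Proof.
move=> theta0 K0 HG; have [normN cvgN] := rateN.
apply: (norm_le_of_lattice normN l_unit (ltW theta0)) => z.
apply: (@cvg_rate_le _ _ _ _ (theta + ln K)) (cvgN z) => k k0.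
have kR : 0 < k%:R :> R by rewrite ltr0n.
apply: (@le_trans _ _ ((theta * radius R (z *+ k) + ln K)%:E * (k%:R^-1)%:E)%E).
  rewrite lee_wpmul2r ?lee_fin ?invr_ge0// leeNl -EFinN.
  apply: le_trans (HG (z *+ k)); rewrite lee_fin.
  by rewrite lnM ?posrE ?expR_gt0 ?invr_gt0// expRK lnV ?posrE//; lra.
rewrite -EFinM lee_fin ler_pdivrMr// mulrDl divfK ?gt_eqF//.
by have := ler_wpM2l (ltW theta0) (radius_multiple z k); lra.
Qed.

(** The point [k * z] lies above [k * s(z) / L] slabs, and each of them contributes a
    factor [kappa].  Bounds in the single direction [l] suffice, since at [l] itself
    the linear form [height l] has the value [1]. *)
Lemma decay_rate_ge kappa S L : 1 < kappa -> 0 < S -> 0 < L ->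
  (forall y (J : nat), J%:R * L < height l y -> (G y <= (ln (S / kappa ^+ J))%:E)%E) ->
  ln kappa / L <= N l.
Proof.
move=> kappa1 S0 L0 HG; have [normN cvgN] := rateN.
have kappa0 : 0 < kappa by exact: lt_trans kappa1.
have lk0 : 0 < ln kappa by exact: ln_gt0.
apply: (norm_ge_of_lattice normN l_unit); first by rewrite divr_ge0// ltW.
move=> z; have [z0|z0] := leP (height l z) 0.
  by rewrite (le_trans _ (norm_nonneg normN _))// mulr_ge0_le0// divr_ge0// ltW.
apply: (@cvg_rate_ge _ _ _ _ (ln S + ln kappa *+ 2)) (cvgN z) => k k0.
have kR : 0 < k%:R :> R by rewrite ltr0n.
pose x := k%:R * height l z / L.
have x0 : 0 < x by rewrite divr_gt0// mulr_gt0.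
(* The largest number of whole slabs strictly below k * z, up to one. *)
pose J := (Num.truncn x).-1.
have /andP[xJ Jx] := truncn_itv (ltW x0).
have J_lt : J%:R < x.
  rewrite /J; case: (Num.truncn x) xJ => [|m] //= xm.
  by apply: lt_le_trans xm; rewrite ltr_nat.
have J_ge : x - 2 <= J%:R.
  have : (Num.truncn x).+1%:R <= J%:R + 2 :> R.
    by rewrite -natrD ler_nat /J; case: (Num.truncn x) => [|m] //=; rewrite addn2.
  by lra.
have JL : J%:R * L < height l (z *+ k).
  by rewrite heightMn -ltr_pdivlMr.
apply: (@le_trans _ _ ((J%:R * ln kappa - ln S)%:E * (k%:R^-1)%:E)%E).
  rewrite -EFinM lee_fin ler_pdivlMr// mulrBl divfK ?gt_eqF//.
  have -> : ln kappa / L * height l z * k%:R = ln kappa * x by rewrite /x; ring.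
  by have := ler_wpM2l (ltW lk0) J_ge; lra.
rewrite lee_wpmul2r ?lee_fin ?invr_ge0// leeNr -EFinN.
apply: le_trans (HG _ _ JL) _; rewrite lee_fin.
rewrite lnM ?posrE ?invr_gt0 ?exprn_gt0// lnV ?posrE ?exprn_gt0// lnXn//.
by rewrite -mulr_natl; lra.
Qed.

End decay_rate.

Lemma lne_ge (R : realType) (p : R) (x : \bar R) :
  0 < p -> (p%:E <= x)%E -> ((ln p)%:E <= lne x)%E.
Proof.
move=> p0; case: x => [r|_|] /=; [|by rewrite leey|by rewrite leeNy_eq].
rewrite lee_fin => pr; have r0 : 0 < r by exact: lt_le_trans pr.
case: ifPn => [|_]; first by rewrite leNgt r0.
by rewrite lee_fin ler_ln ?posrE.
Qed.

Lemma lne_le (R : realType) (W : R) (x : \bar R) :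
  0 < W -> (x <= W%:E)%E -> (lne x <= (ln W)%:E)%E.
Proof.
move=> W0; case: x => [r| |_] /=; [|by rewrite leye_eq|by rewrite leNye].
rewrite lee_fin => rW; case: ifPn => [_|]; first by rewrite leNye.
by rewrite -ltNge => r0; rewrite lee_fin ler_ln ?posrE.
Qed.

Section fixed_coupling.
Context (dT : measure_display) (T : measurableType dT) (R : realType).
Variables (P : probability T R) (d : nat) (V : 'Zd_d -> {RV P >-> R}).
Variables (l : 'rV[R]_d) (gamma : R) (A B : 'rV[R]_d -> R).
Hypothesis d0 : (0 < d)%N.
Hypothesis iidV : iid V.
Hypothesis V0 : forall x w, 0 <= V x w.
Hypothesis l_unit : \sum_(i < d) l 0 i ^+ 2 = 1.
Hypothesis gamma0 : 0 < gamma.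
Hypothesis quenchedA : is_quenched_exponent P (fun x w => gamma * V x w) A.
Hypothesis annealedB : is_annealed_exponent P (fun x w => gamma * V x w) B.
Local Notation U := (fun x w => gamma * V x w).

Let U0 x w : 0 <= U x w.
Proof. by rewrite mulr_ge0// ltW. Qed.

Let mU x : measurable_fun setT (U x).
Proof. by apply: measurable_funM => //; exact: measurable_cst. Qed.

Let uniqU :
  {ae P, forall w, unique (bounded_green_solution (U ^~ w)) (green (U ^~ w))}.
Proof. exact: green_unique_ae quenchedA. Qed.

Let rateA : decay_rate (fun y => 'E_P[fun w => ln (green (U ^~ w) y)])%E A.
Proof. by case: quenchedA. Qed.

Let rateB : decay_rate (fun y => lne 'E_P[fun w => green (U ^~ w) y])%E B.
Proof. by case: annealedB. Qed.

Lemma integral_site x : (\int[P]_w (V x w)%:E = \int[P]_w (V 0 w)%:E)%E.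
Proof.
have mabs : measurable_fun setT (fun r : R => `|r|%:E).
  by apply/measurable_EFinP; exact: normr_measurable.
have dist k : (\int[P]_w (V k w)%:E = \int[distribution P (V k)]_r `|r|%:E)%E.
  rewrite ge0_integral_distribution//; apply: eq_integral => w _ /=.
  by rewrite ger0_norm.
rewrite !dist; apply: eq_measure_integral => S mS _.
by have [_] := iidV; exact.
Qed.

Lemma exponents_le mu theta : (\int[P]_w (V 0 w)%:E = mu%:E)%E -> 0 < mu ->
  0 < theta -> (2 * d)%:R * (expR (gamma * mu) - 1) < theta ^+ 2 ->
  A l <= theta /\ B l <= theta.
Proof.
move=> Vmu mu0 theta0 c_theta; pose b := gamma * mu.
have b0 : 0 < b by rewrite mulr_gt0.
have c0 : 0 < expR b - 1 by rewrite subr_gt0 -expR0 ltr_expR.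
have cU x : centered P (fun w => b - U x w).
  have intV : P.-integrable setT (EFin \o V x).
    apply/integrableP; split; first by apply/measurable_EFinP.
    rewrite (eq_integral (EFin \o V x)) => [|w _]; last by rewrite gee0_abs// lee_fin.
    by rewrite [ltLHS](_ : _ = mu%:E) ?ltry// -Vmu -(integral_site x).
  have intU := integrableZl measurableT (- gamma) intV.
  have intb : P.-integrable setT (EFin \o (fun=> b)).
    exact: finite_measure_integrable_cst.
  have E w : (b - U x w)%:E = (b%:E + (- gamma)%:E * (V x w)%:E)%E.
    by rewrite -EFinM -EFinD mulNr.
  split.
    rewrite (_ : _ \o _ = (fun w => b%:E + (- gamma)%:E * (V x w)%:E)%E).
      exact: integrableD.
    by apply/funext => w; exact: E.
  under eq_integral do rewrite E.
  rewrite integralD// integralZl// integral_site Vmu integral_cst_probability.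
  by rewrite -EFinM -EFinD mulNr subrr.
have [K K0 HK] := @radial_le_greenN R d (expR b - 1) theta d0 c0 theta0 c_theta.
have p0 (y : 'Zd_d) : 0 < radial theta y / K by rewrite divr_gt0// expR_gt0.
split; [apply: (decay_rate_le rateA l_unit theta0 K0) => y|
        apply: (decay_rate_le rateB l_unit theta0 K0) => y]; have [n Hn] := HK y;
  have pn : radial theta y / K <= greenN (fun=> expR b - 1) n y
    by rewrite ler_pdivrMr// mulrC.
- exact: (mean_ln_green_ge d0 U0 uniqU (ltW b0) cU (p0 y) pn).
- by apply: lne_ge => //; exact: (mean_green_ge d0 U0 uniqU (ltW b0) cU (p0 y) pn).
Qed.

Lemma exponents_ge M L theta : 0 <= M -> 1 < L -> 0 < theta ->
  site_error d L gamma M <= 1 ->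
  \sum_(i < d) coshR (theta * l 0 i) <=
    d%:R * (1 + (1 - site_error d L gamma M) * (gamma * truncated_mean V M)) ->
  ln (slab_gain L theta) / L <= A l /\ ln (slab_gain L theta) / L <= B l.
Proof.
move=> M0 L1 theta0 err cosh_a.
have gain1 : 1 < slab_gain L theta by exact: slab_gain_gt1.
have gain0 : 0 < slab_gain L theta by exact: lt_trans gain1.
pose S := source_size d L theta * slab_gain L theta.
have S0 : 0 < S by rewrite mulr_gt0// source_size_gt0.
have L0 : 0 < L by exact: lt_trans L1.
have meanW y (J : nat) : J%:R * L < height l y -> forall n,
    \int[P]_w greenN (U ^~ w) n y <= S / slab_gain L theta ^+ J.
  move=> Jy n.
  exact: (mean_greenN_le d0 iidV V0 l_unit L1 theta0 gamma0 M0 err cosh_a n Jy).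
have W0 (J : nat) : 0 < S / slab_gain L theta ^+ J by rewrite divr_gt0// exprn_gt0.
split; [apply: (decay_rate_ge rateA l_unit gain1 S0 L0) => y J Jy|
        apply: (decay_rate_ge rateB l_unit gain1 S0 L0) => y J Jy].
- exact: (mean_ln_green_le d0 U0 mU uniqU (W0 J) (meanW y J Jy)).
- by apply: lne_le => //; exact: (mean_green_le d0 U0 mU uniqU (meanW y J Jy)).
Qed.

Lemma exponents_nonneg : 0 <= A l /\ 0 <= B l.
Proof. by split; apply: norm_nonneg; [case: rateA|case: rateB]. Qed.

End fixed_coupling.

(** * Vanishing coupling constant *)

Section truncation.
Context (dT : measure_display) (T : measurableType dT) (R : realType).
Variables (P : probability T R) (d : nat) (V : 'Zd_d -> {RV P >-> R}).
Hypothesis iidV : iid V.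
Hypothesis V0 : forall x w, 0 <= V x w.

Lemma truncated_mean_gt (t : R) : (t%:E < \int[P]_w (V 0 w)%:E)%E ->
  exists2 M, 0 <= M & t < truncated_mean V M.
Proof.
move=> tV; apply: contrapT => noM.
have meanE (n : nat) : (\int[P]_w (truncated V n%:R 0 w)%:E = (truncated_mean V n%:R)%:E)%E.
  exact: integral_truncated.
have cvgV w : (truncated V n%:R 0 w)%:E @[n --> \oo] --> (V 0 w)%:E.
  apply: cvg_near_cst; near=> n; congr EFin; rewrite /truncated min_l//.
  by near: n; exact: nbhs_infty_ger.
have nd w : nondecreasing_seq (fun n => (truncated V n%:R 0 w)%:E).
  by move=> m n mn; rewrite lee_fin le_min2 // ler_nat.
have : (\int[P]_w (V 0 w)%:E <= t%:E)%E.
  rewrite (eq_integral (fun w => limn (fun n => (truncated V n%:R 0 w)%:E))); last first.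
    by move=> w _; apply/esym/cvg_lim => //; exact: cvgV.
  rewrite monotone_convergence//; last 2 first.
  - by move=> n; apply/measurable_EFinP; exact: measurable_truncated.
  - by move=> n w _; rewrite lee_fin; exact: truncated_ge0.
  apply: lime_le.
    apply: ereal_nondecreasing_is_cvgn => m n mn; apply: ge0_le_integral => //.
    - by move=> w _; rewrite lee_fin; exact: truncated_ge0.
    - by apply/measurable_EFinP; exact: measurable_truncated.
    - by apply/measurable_EFinP; exact: measurable_truncated.
    - by move=> w _; exact: nd.
  near=> n; rewrite meanE lee_fin leNgt; apply/negP => tn.
  by apply: noM; exists n%:R.
by rewrite leNgt tV.
Unshelve. all: by end_near. Qed.

Lemma mean_gt0 : (0 < P [set w | (0 < V 0%R w)%R])%E -> (0 < \int[P]_w (V 0 w)%:E)%E.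
Proof.
move=> PV; rewrite lt_neqAle integral_ge0 ?andbT; last by move=> w _; rewrite lee_fin.
apply/eqP => V00.
have : (\int[P]_w `|(V 0 w)%:E| = 0)%E.
  by rewrite V00; apply: eq_integral => w _; rewrite gee0_abs// lee_fin.
move/(ae_eq_integral_abs P measurableT) => /(_ _)[]; first exact/measurable_EFinP.
move=> N [mN PN VN]; move: PV; rewrite ltNge => /negP; apply.
have mVpos : measurable [set w | 0 < V 0 w].
  rewrite (_ : [set w | _] = V 0 @^-1` `]0, +oo[%classic).
    by rewrite -[X in measurable X]setTI; exact: measurable_funP.
  by apply/seteqP; split => w /=; rewrite in_itv/= andbT.
rewrite -PN; apply: le_measure; rewrite ?inE// => w /= Vw.
by apply: VN => /= /(_ I) [] V0w; move: Vw; rewrite V0w ltxx.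
Qed.

End truncation.

Section small_coupling.
Context (R : realType) (d : nat) (l : 'rV[R]_d).
Hypothesis d0 : (0 < d)%N.
Hypothesis l_unit : \sum_(i < d) l 0 i ^+ 2 = 1.

Lemma sum_coshR_le theta : 0 <= theta -> theta < 2 ->
  \sum_(i < d) coshR (theta * l 0 i) <= d%:R + theta ^+ 2 / 2 / (1 - theta / 2) ^+ 2.
Proof.
move=> t0 t2; have den0 : 0 < 1 - theta / 2 by lra.
apply: (@le_trans _ _ (\sum_(i < d)
    (1 + l 0 i ^+ 2 * (theta ^+ 2 / 2 / (1 - theta / 2) ^+ 2)))); last first.
  by rewrite big_split/= -mulr_suml l_unit mul1r sumr_const card_ord.
apply: ler_sum => i _; have li := unit_coord_le1 l_unit i.
have tl : `|theta * l 0 i| <= theta by rewrite normrM ger0_norm// ler_piMr.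
apply: le_trans (coshR_le (le_lt_trans tl t2)) _; rewrite lerD2l exprMn.
have den : 1 - theta / 2 <= 1 - `|theta * l 0 i| / 2 by lra.
have inv_den : (1 - `|theta * l 0 i| / 2) ^- 2 <= (1 - theta / 2) ^- 2.
  rewrite lef_pV2 ?posrE ?exprn_gt0//; last exact: lt_le_trans den.
  by rewrite ler_pXn2r ?nnegrE ?(ltW den0)// (le_trans (ltW den0)).
by have := ler_wpM2l (mulr_ge0 (sqr_ge0 theta) (sqr_ge0 (l 0 i))) inv_den; lra.
Qed.

Lemma ln_slab_gain_ge (theta L : R) : theta * (L - 1) - ln 2 <= ln (slab_gain L theta).
Proof.
rewrite -[X in X - _]expRK -ln_div ?posrE ?expR_gt0//.
have gain0 : 0 < slab_gain L theta by exact: (lt_le_trans ltr01 (coshR_ge1 _)).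
have exp0 : 0 < expR (theta * (L - 1)) / 2 by rewrite divr_gt0 ?expR_gt0.
rewrite ler_ln ?posrE//.
by rewrite /slab_gain /coshR ler_pM2r ?invr_gt0// lerDl expR_ge0.
Qed.

(** With [sigma] the fourth root of the coupling constant, slabs of width
    [sigma ^- 3] are wide compared with the decay length, of order [sigma ^- 2],
    while the number of charged visits to a site, of the order of that width, is
    small compared with the [sigma ^- 4] visits after which a single site would
    matter.  All relative errors are then of order [sigma]. *)
Lemma slab_parameters (m M t r sigma : R) :
  0 <= M -> 0 < t -> t ^+ 2 < (2 * d)%:R * m -> r < t ->
  0 < sigma -> sigma < 1 -> t * sigma <= 1 ->
  (2 * d)%:R * M * 2 * sigma <= 1 ->
  ((2 * d)%:R * M * 2 + t) * (2 * d)%:R * m * sigma <= (2 * d)%:R * m - t ^+ 2 ->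
  (t + ln 2) * sigma <= t - r ->
  let gamma := sigma ^+ 4 in let L := sigma ^- 3 in let theta := t * sigma ^+ 2 in
  [/\ 1 < L, 0 < theta, site_error d L gamma M <= 1,
      \sum_(i < d) coshR (theta * l 0 i) <=
        d%:R * (1 + (1 - site_error d L gamma M) * (gamma * m)) &
      r * sigma ^+ 2 <= ln (slab_gain L theta) / L].
Proof.
move=> M0 t0 tm rt s0 s1 ts1 err1 err2 err3 gamma L theta.
have sN : sigma != 0 by rewrite gt_eqF.
have s30 : 0 < sigma ^+ 3 by rewrite exprn_gt0.
have s20 : 0 < sigma ^+ 2 by rewrite exprn_gt0.
have s4 : sigma ^+ 4 <= sigma by rewrite -[leRHS]expr1 ler_wiXn2l// ltW.
have s3 : sigma ^+ 3 <= sigma by rewrite -[leRHS]expr1 ler_wiXn2l// ltW.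
have s2 : sigma ^+ 2 <= sigma by rewrite -[leRHS]expr1 ler_wiXn2l// ltW.
have errE : site_error d L gamma M = (2 * d)%:R * M * (sigma + sigma ^+ 4).
  by rewrite /site_error /gamma /L; field.
have dM0 : 0 <= (2 * d)%:R * M by rewrite mulr_ge0.
have err_le : site_error d L gamma M <= (2 * d)%:R * M * 2 * sigma.
  by rewrite errE -[leRHS]mulrA; apply: ler_wpM2l => //; lra.
have theta0 : 0 < theta by rewrite mulr_gt0.
have theta_le : theta <= t * sigma by rewrite ler_pM2l.
split => //.
- by rewrite /L invf_gt1// exprn_ilt1// ltW.
- exact: le_trans err1.
- apply: le_trans (sum_coshR_le (ltW theta0) _) _; first by lra.
  set e := site_error d L gamma M in err_le *.
  rewrite mulrDr mulr1 lerD2l.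
  have den0 : 0 < 1 - theta / 2 by lra.
  rewrite ler_pdivrMr ?exprn_gt0// ler_pdivrMr//.
  have bern : 1 - e - theta <= (1 - e) * (1 - theta / 2) ^+ 2.
    have : 0 <= 1 - e by lra.
    have e0 : 0 <= e.
      rewrite /e errE; apply: mulr_ge0 => //.
      by apply: addr_ge0; [exact: ltW|apply: exprn_ge0; exact: ltW].
    have theta4 : 0 <= theta * (1 - theta / 4).
      by apply: mulr_ge0; [exact: ltW|lra].
    have := mulr_ge0 e0 theta4.
    by have := sqr_ge0 theta; nra.
  have dm0 : 0 < (2 * d)%:R * m by apply: lt_trans tm; rewrite exprn_gt0.
  have key : t ^+ 2 <= (2 * d)%:R * m * ((1 - e) * (1 - theta / 2) ^+ 2).
    apply: (@le_trans _ _ ((2 * d)%:R * m * (1 - e - theta))); last by rewrite ler_pM2l.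
    have : (2 * d)%:R * m * (e + theta) <=
        (2 * d)%:R * m * (((2 * d)%:R * M * 2 + t) * sigma).
      by rewrite ler_pM2l//; lra.
    by move: err2; lra.
  have := ler_wpM2l (exprn_ge0 4 (ltW s0)) key.
  have -> : sigma ^+ 4 * t ^+ 2 = theta ^+ 2 by rewrite /theta; ring.
  by rewrite /gamma natrM; lra.
- rewrite ler_pdivlMr ?invr_gt0//; apply: le_trans (ln_slab_gain_ge _ _).
  rewrite /theta /L; have -> : r * sigma ^+ 2 * sigma ^- 3 = r / sigma by field.
  have -> : t * sigma ^+ 2 * (sigma ^- 3 - 1) = (t - t * sigma ^+ 3) / sigma by field.
  rewrite -(ler_pM2r s0) mulrBl !divfK//.
  have ln20 : 0 < ln 2 :> R by rewrite ln_gt0// ltr1n.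
  have : t * sigma ^+ 3 <= t * sigma by rewrite ler_pM2l.
  by move: err3; lra.
Qed.

Lemma near_fourth_root (delta : R) : 0 < delta ->
  \forall gamma \near (0 : R)^'+, 0 < Num.sqrt (Num.sqrt gamma) /\ Num.sqrt (Num.sqrt gamma) < delta.
Proof.
move=> de0; near=> gamma; have g0 : 0 < gamma by near: gamma; exact: nbhs_right_gt.
have s0 : 0 < Num.sqrt gamma by rewrite sqrtr_gt0.
split; first by rewrite sqrtr_gt0.
have -> : delta = Num.sqrt (Num.sqrt (delta ^+ 4)).
  have -> : delta ^+ 4 = (delta ^+ 2) ^+ 2 by rewrite -exprM.
  by rewrite sqrtr_sqr (ger0_norm (sqr_ge0 _)) sqrtr_sqr gtr0_norm.
rewrite ltr_sqrt ?sqrtr_gt0 ?exprn_gt0// ltr_sqrt ?exprn_gt0//.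
near: gamma; apply: nbhs_right_lt; exact: exprn_gt0.
Unshelve. all: by end_near. Qed.

End small_coupling.

Lemma cvg_EFin_between (R : realType) (F : set_system R) (f : R -> R) (t : R) :
  Filter F ->
  (forall r, t < r -> \forall x \near F, f x <= r) ->
  (forall r, r < t -> \forall x \near F, r <= f x) ->
  (f x)%:E @[x --> F] --> t%:E.
Proof.
move=> FF upper lower; apply: cvg_EFin; first by near=> x.
apply/cvgrPdist_le => e e0; have [te et] : t < t + e /\ t - e < t by split; lra.
near=> x; rewrite ler_distlC; apply/andP; split; near: x.
  exact: lower.
exact: upper.
Unshelve. all: by end_near. Qed.

Section vanishing_coupling.
Context (dT : measure_display) (T : measurableType dT) (R : realType).
Variables (P : probability T R) (d : nat) (V : 'Zd_d -> {RV P >-> R}).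
Variables (A B : R -> 'rV[R]_d -> R) (l : 'rV[R]_d).
Hypothesis d0 : (0 < d)%N.
Hypothesis iidV : iid V.
Hypothesis V0 : forall x w, 0 <= V x w.
Hypothesis l_unit : \sum_(i < d) l 0 i ^+ 2 = 1.
Hypothesis quA : forall gamma : R, 0 < gamma ->
  is_quenched_exponent P (fun x w => gamma * V x w) (A gamma).
Hypothesis anB : forall gamma : R, 0 < gamma ->
  is_annealed_exponent P (fun x w => gamma * V x w) (B gamma).
Local Notation EV := (\int[P]_w (V 0%R w)%:E)%E.

Let d2 : 0 < (2 * d)%:R :> R.
Proof. by rewrite ltr0n muln_gt0. Qed.

Lemma exponents_nonneg_near : \forall gamma \near (0 : R)^'+,
  0 <= A gamma l / Num.sqrt gamma /\ 0 <= B gamma l / Num.sqrt gamma.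
Proof.
near=> gamma.
have gamma0 : 0 < gamma by near: gamma; exact: nbhs_right_gt.
have [A0 B0] := exponents_nonneg l (quA gamma0) (anB gamma0).
by split; rewrite divr_ge0// sqrtr_ge0.
Unshelve. all: by end_near. Qed.

Lemma exponents_ge_near r : 0 <= r -> ((r ^+ 2)%:E < (2 * d)%:R%:E * EV)%E ->
  \forall gamma \near (0 : R)^'+,
    r <= A gamma l / Num.sqrt gamma /\ r <= B gamma l / Num.sqrt gamma.
Proof.
move=> r0 rEV.
have rEV' : ((r ^+ 2 / (2 * d)%:R)%:E < EV)%E.
  by rewrite EFinM lte_pdivrMr// muleC.
have [M M0 rM] := truncated_mean_gt iidV V0 rEV'.
set m := truncated_mean V M in rM.
have r2m : r ^+ 2 < (2 * d)%:R * m by rewrite mulrC -ltr_pdivrMr.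
have m0 : 0 < m by apply: le_lt_trans rM; rewrite divr_ge0 ?sqr_ge0// ltW.
(* The excess of t over r pays for the errors of order sigma. *)
pose t := (r + Num.sqrt ((2 * d)%:R * m)) / 2.
have rs : r < Num.sqrt ((2 * d)%:R * m).
  by rewrite -[r]ger0_norm// -sqrtr_sqr ltr_sqrt// mulr_gt0.
have rt : r < t by rewrite /t; lra.
have t0 : 0 < t by exact: le_lt_trans rt.
have tm : t ^+ 2 < (2 * d)%:R * m.
  rewrite -[ltRHS]sqr_sqrtr; last by rewrite mulr_ge0// ltW.
  by rewrite ltr_pXn2r ?nnegrE ?sqrtr_ge0 ?(ltW t0)// /t; lra.
have small a c : 0 <= a -> 0 < c -> \forall gamma \near (0 : R)^'+,
    a * Num.sqrt (Num.sqrt gamma) <= c.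
  move=> a0 c0; have de0 : 0 < c / (a + 1) by rewrite divr_gt0// ltr_wpDl.
  near=> gamma; have [s0 sde] : 0 < Num.sqrt (Num.sqrt gamma) /\
      Num.sqrt (Num.sqrt gamma) < c / (a + 1) by near: gamma; exact: near_fourth_root.
  have : Num.sqrt (Num.sqrt gamma) * (a + 1) < c by rewrite -ltr_pdivlMr// ltr_wpDl.
  by lra.
have dM0 : 0 <= (2 * d)%:R * M * 2 by rewrite !mulr_ge0.
have ln20 : 0 < ln 2 :> R by rewrite ln_gt0// ltr1n.
have c1 := small t 1 (ltW t0) ltr01.
have c2 := small _ 1 dM0 ltr01.
have a3 : 0 <= ((2 * d)%:R * M * 2 + t) * (2 * d)%:R * m.
  by rewrite !mulr_ge0 ?addr_ge0// ltW.
have gap2 : 0 < (2 * d)%:R * m - t ^+ 2 by rewrite subr_gt0.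
have gap1 : 0 < t - r by rewrite subr_gt0.
have c3 := small _ _ a3 gap2.
have a4 : 0 <= t + ln 2 by rewrite addr_ge0// ltW.
have c4 := small _ _ a4 gap1.
near=> gamma.
have gamma0 : 0 < gamma by near: gamma; exact: nbhs_right_gt.
have [s0 s1] : 0 < Num.sqrt (Num.sqrt gamma) /\ Num.sqrt (Num.sqrt gamma) < 1.
  by near: gamma; exact: near_fourth_root.
set sigma := Num.sqrt (Num.sqrt gamma) in s0 s1.
have sigma2 : sigma ^+ 2 = Num.sqrt gamma by rewrite sqr_sqrtr// sqrtr_ge0.
have sigma4 : sigma ^+ 4 = gamma.
  by rewrite (exprM sigma 2 2) sigma2 sqr_sqrtr// ltW.
have [||||L1 theta0 err cosh_a rate] :=
  slab_parameters l_unit M0 t0 tm rt s0 s1.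
- by rewrite /sigma; near: gamma.
- by rewrite /sigma; near: gamma.
- by rewrite /sigma; near: gamma.
- by rewrite /sigma; near: gamma.
rewrite sigma4 in err cosh_a.
have [lA lB] := exponents_ge d0 iidV V0 l_unit gamma0 (quA gamma0) (anB gamma0)
  M0 L1 theta0 err cosh_a.
have sq0 : 0 < Num.sqrt gamma by rewrite sqrtr_gt0.
by split; rewrite ler_pdivlMr// -sigma2 (le_trans rate).
Unshelve. all: by end_near. Qed.

Lemma exponents_le_near mu r : EV = mu%:E -> 0 < mu -> 0 < r ->
  (2 * d)%:R * mu < r ^+ 2 ->
  \forall gamma \near (0 : R)^'+,
    A gamma l / Num.sqrt gamma <= r /\ B gamma l / Num.sqrt gamma <= r.
Proof.
move=> EVE mu0 r0 mur; have r2 : 0 < r ^+ 2 by rewrite exprn_gt0.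
have gap : 0 < r ^+ 2 - (2 * d)%:R * mu by rewrite subr_gt0.
have dmu0 : 0 < (2 * d)%:R * mu by rewrite mulr_gt0.
near=> gamma.
have gamma0 : 0 < gamma by near: gamma; exact: nbhs_right_gt.
have gmu : gamma * (mu * r ^+ 2) < r ^+ 2 - (2 * d)%:R * mu.
  rewrite -ltr_pdivlMr ?mulr_gt0//; near: gamma; apply: nbhs_right_lt.
  by rewrite divr_gt0// mulr_gt0.
have sq0 : 0 < Num.sqrt gamma by rewrite sqrtr_gt0.
have theta0 : 0 < r * Num.sqrt gamma by rewrite mulr_gt0.
have gmu1 : gamma * mu < 1.
  by rewrite -(ltr_pM2r r2) mul1r -mulrA (lt_le_trans gmu)// gerBl ltW.
(* expR x - 1 <= x / (1 - x), from expR (- x) >= 1 - x. *)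
have exp_le : expR (gamma * mu) - 1 <= gamma * mu / (1 - gamma * mu).
  have x1 : 0 < 1 - gamma * mu by rewrite subr_gt0.
  have : expR (gamma * mu) <= (1 - gamma * mu)^-1.
    by rewrite -[leLHS]invrK -expRN lef_pV2 ?posrE ?expR_gt0// expR_ge1Dx.
  have -> : gamma * mu / (1 - gamma * mu) = (1 - gamma * mu)^-1 - 1.
    by field; rewrite gt_eqF.
  by lra.
have c_theta : (2 * d)%:R * (expR (gamma * mu) - 1) < (r * Num.sqrt gamma) ^+ 2.
  apply: (@le_lt_trans _ _ ((2 * d)%:R * (gamma * mu / (1 - gamma * mu)))).
    by rewrite ler_pM2l.
  rewrite exprMn sqr_sqrtr ?(ltW gamma0)// mulrA ltr_pdivrMr ?subr_gt0//.
  have : gamma * (gamma * (mu * r ^+ 2)) < gamma * (r ^+ 2 - (2 * d)%:R * mu).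
    by rewrite ltr_pM2l.
  by lra.
have [uA uB] := exponents_le d0 iidV V0 l_unit gamma0 (quA gamma0) (anB gamma0)
  EVE mu0 theta0 c_theta.
by split; rewrite ler_pdivrMr.
Unshelve. all: by end_near. Qed.

End vanishing_coupling.

Theorem theorem1 (R : realType) (dT : measure_display) (T : measurableType dT)
    (P : probability T R) (d : nat) (V : 'Zd_d -> {RV P >-> R})
    (A B : R -> 'rV[R]_d -> R) (l : 'rV[R]_d) :
  (1 <= d)%N ->
  iid V ->
  (forall x w, 0 <= V x w) ->
  (0 < P [set w | (0 < V 0%R w)%R])%E ->
  ('E_P[fun w => ln (V 0%R w + 1)] < +oo)%E ->
  (forall gamma : R, 0 < gamma ->
     is_quenched_exponent P (fun x w => gamma * V x w) (A gamma)) ->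
  (forall gamma : R, 0 < gamma ->
     is_annealed_exponent P (fun x w => gamma * V x w) (B gamma)) ->
  norm2 l = 1 ->
  (fun gamma : R => (A gamma l / Num.sqrt gamma)%:E) @ 0^'+
    --> sqrte ((2 * d)%:R%:E * 'E_P[V 0%R])%E /\
  (fun gamma : R => (B gamma l / Num.sqrt gamma)%:E) @ 0^'+
    --> sqrte ((2 * d)%:R%:E * 'E_P[V 0%R])%E.
Proof.
move=> d0 iidV V0 PV _ quA anB l1.
have l_unit : \sum_(i < d) l 0 i ^+ 2 = 1.
  rewrite -[LHS]sqr_sqrtr; last by apply: sumr_ge0 => i _; exact: sqr_ge0.
  by rewrite -/(norm2 l) l1 expr1n.
have d2 : 0 < (2 * d)%:R :> R by rewrite ltr0n muln_gt0.
have EV0 := mean_gt0 V0 PV.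
have nonneg := exponents_nonneg_near l quA anB.
have lower := exponents_ge_near d0 iidV V0 l_unit quA anB.
have upper := exponents_le_near d0 iidV V0 l_unit quA anB.
have lower_neg r : r < 0 -> \forall gamma \near (0 : R)^'+,
    r <= A gamma l / Num.sqrt gamma /\ r <= B gamma l / Num.sqrt gamma.
  by move=> r0; apply: filterS nonneg => gamma [A0 B0]; split; apply: le_trans (ltW r0) _.
rewrite unlock; case EVE : (\int[P]_w (V 0 w)%:E)%E EV0 lower upper =>
  [mu| |] // mu0 lower upper; last first.
  rewrite gt0_muley ?lte_fin//=.
  have all_r r : \forall gamma \near (0 : R)^'+,
      r <= A gamma l / Num.sqrt gamma /\ r <= B gamma l / Num.sqrt gamma.
    have [r0|] := leP 0 r; last exact: lower_neg.
    by apply: lower => //; rewrite gt0_muley ?lte_fin// ltry.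
  by split; apply/cvgeyPge => r; apply: filterS (all_r r) => gamma [];
    rewrite lee_fin.
rewrite -EFinM /=; set t := Num.sqrt _.
have {}mu0 : 0 < mu by [].
have t0 : 0 < t by rewrite sqrtr_gt0 mulr_gt0.
have t2 : t ^+ 2 = (2 * d)%:R * mu by rewrite sqr_sqrtr// mulr_ge0// ltW.
have {}upper r : t < r -> \forall gamma \near (0 : R)^'+,
    A gamma l / Num.sqrt gamma <= r /\ B gamma l / Num.sqrt gamma <= r.
  move=> tr; have r0 : 0 < r by exact: lt_trans tr.
  by apply: (upper mu) => //; rewrite -t2 ltr_pXn2r ?nnegrE// ltW.
have {}lower r : r < t -> \forall gamma \near (0 : R)^'+,
    r <= A gamma l / Num.sqrt gamma /\ r <= B gamma l / Num.sqrt gamma.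
  move=> rt; have [r0|] := leP 0 r; last exact: lower_neg.
  by apply: lower => //; rewrite -EFinM lte_fin -t2 ltr_pXn2r ?nnegrE// ltW.
by split; apply: cvg_EFin_between => r rt;
  (apply: filterS (upper r rt) || apply: filterS (lower r rt)) => gamma [].
Qed.
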